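(* Let $d=d(n)\ge 0$ be integers and $p=p(n)\in(0,1]$. Let $H=H_n$ be any sequence of finite graphs, each with at least one edge. Define \[ \Phi(H) := \sum_{\emptyset\neq\Gamma\subseteq H}\left(\frac{20|V(H)|}{n}\right)^{|V(\Gamma)|}\frac{(d+1)^{f(\Gamma)}}{p^{|E(\Gamma)|}}, \] where the sum is over the non-empty subgraphs $\Gamma$ of $H$ and $f(\Gamma)$ is the edge cover number of $\Gamma$. Suppose $d\,|E(H)|\,|V(H)|/n<0.9$. Then for any $d$-dependent random graph distribution $G\sim G_{n,p,d}$ on $n$ vertices with edge probability $p$, the probability that $G$ contains no copies of $H$ is at most $10\,\Phi(H)$. In particular, define $m(H)=\max_{\emptyset\neq\Gamma\subseteq H}|E(\Gamma)|/|V(\Gamma)|$. If $H$ is fixed (independent of $n$) and $p\,(n/(d+1))^{1/m(H)}\to\infty$ as $n\to\infty$, then $G$ almost surely contains a copy of $H$.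
   Context: A dependency graph for a finite family of random variables $(X_i)_{i\in I}$ is a (simple, undirected) graph on vertex set $I$ such that each $X_i$ is independent of the family of all $X_j$ ($j\ne i$) with $j$ not adjacent to $i$ (the notion used in the Lovász local lemma and Janson's inequality). The variables are $d$-locally dependent if they have a dependency graph of maximum degree at most $d$. A $d$-dependent random graph $G_{n,p,d}$ is any probability distribution on simple graphs on $n$ (labelled) vertices such that each of the $\binom n2$ potential edges is present with probability exactly $p$, and the indicator variables of the edges are $d$-locally dependent. The notation $G\sim G_{n,p,d}$ means $G$ is drawn from such a distribution. The parameters $p$ and $d$ may depend on $n$. An event happens almost surely if its probability tends to $1$ as $n\to\infty$. For a graph $\Gamma$, $V(\Gamma)$ and $E(\Gamma)$ denote its vertex and edge sets. A non-empty subgraph $\emptyset\ne\Gamma\subseteq H$ corresponds to a non-empty subset of $E(H)$: $E(\Gamma)$ is this subset and $V(\Gamma)$ is the set of endpoints of its edges (so $\Gamma$ has no isolated vertices); distinct edge subsets give distinct terms of the sum. The edge cover number $f(\Gamma)$ is the minimum number of edges in a set $A\subseteq E(\Gamma)$ such that every vertex of $\Gamma$ is an endpoint of some edge of $A$. A copy of $H$ in $G$ is a (not necessarily induced) subgraph of $G$ isomorphic to $H$. *)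

(* Defs.v *)
From HB Require Import structures.
From mathcomp Require Import all_boot all_order all_algebra.

Set Implicit Arguments.
Unset Strict Implicit.
Unset Printing Implicit Defensive.

Import Order.TTheory GRing.Theory Num.Theory.

Definition pedge (V : finType) : finType := {e : {set V} | #|e| == 2}.

(* A simple graph with vertex set V, given by its edge set; V may contain
   isolated vertices. *)
Definition sgraph (V : finType) := {set pedge V}.

Section Graphs.
Variable V : finType.
Implicit Types G F : sgraph V.

(* Irreflexive, since [set x; x] is a singleton. *)
Definition adj G (x y : V) : bool := [exists e in G, val e == [set x; y]].

Definition degree G (x : V) : nat := #|[set y | adj G x y]|.

(* The set of endpoints of the edges of F, i.e. V(F) when the edge set F is
   regarded as a subgraph without isolated vertices. *)
Definition endpoints F : {set V} := \bigcup_(e in F) val e.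

Definition edge_cover F (A : sgraph V) : bool :=
  (A \subset F) && [forall x in endpoints F, exists e in A, x \in val e].

(* F covers itself, so the minimum ranges over a nonempty family. *)
Definition edge_cover_number F : nat :=
  #|[arg min_(A < F | edge_cover F A) #|A|]|.

Definition nonempty_sub G F : bool := (F != set0) && (F \subset G).

End Graphs.

Section Copies.
Variables W V : finType.
Implicit Types (H : sgraph W) (G F : sgraph V) (U : {set V}).

(* (U, F) is a subgraph of G, with vertex set U and edge set F. *)
Definition subgraph G U F : Prop := F \subset G /\ endpoints F \subset U.

Definition isomorphic_to H U F : Prop :=
  exists f : W -> V,
    [/\ injective f, f @: [set: W] = U
      & forall x y, adj F (f x) (f y) = adj H x y].

Definition contains_copy H G : Prop :=
  exists U F, subgraph G U F /\ isomorphic_to H U F.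

End Copies.

From mathcomp Require Import all_classical all_reals all_analysis.
Import numFieldNormedType.Exports.

Local Open Scope classical_set_scope.
Local Open Scope ring_scope.

HB.instance Definition _ (V : finType) := Finite.on (sgraph V).
HB.instance Definition _ (V : finType) :=
  isPointed.Build (sgraph V) (@finset.set0 (pedge V)).
HB.instance Definition _ (V : finType) :=
  @isMeasurable.Build default_measure_display (sgraph V)
    discrete_measurable discrete_measurable0
    discrete_measurableC discrete_measurableU.

Section Dependency.
Context d d' (T : measurableType d) (E : measurableType d') (R : realType).
Variables (P : probability T R) (I : finType) (X : I -> {RV P >-> E}).

Definition sigma_family (S : set I) : set_system T :=
  <<s \bigcup_(j in S) g_sigma_algebra_preimage (X j) >>.

Definition independent_of_family (i : I) (S : set I) : Prop :=
  forall A B : set T, g_sigma_algebra_preimage (X i) A -> sigma_family S B ->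
    P (A `&` B) = (P A * P B)%E.

Definition dependency_graph (D : sgraph I) : Prop :=
  forall i, independent_of_family i [set j | j != i /\ ~~ adj D i j].

Definition locally_dependent (k : nat) : Prop :=
  exists D : sgraph I, dependency_graph D /\ forall i, (degree D i <= k)%N.

End Dependency.

Section RandomGraphs.
Context (R : realType) (V : finType).
Variable P : probability (sgraph V) R.

Definition edge_indicator (e : pedge V) : sgraph V -> bool := fun G => e \in G.

Lemma measurable_edge_indicator e : measurable_fun setT (edge_indicator e).
Proof. by []. Qed.

HB.instance Definition _ e :=
  isMeasurableFun.Build _ _ _ _ (edge_indicator e)
    (measurable_edge_indicator e).

Definition edge_rv (e : pedge V) : {RV P >-> bool} := edge_indicator e.

(* P is one of the distributions denoted G_{n,p,d}, with n = #|V|. *)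
Definition dependent_random_graph (p : R) (d : nat) : Prop :=
  (forall e, P [set G : sgraph V | e \in G] = p%:E) /\
  locally_dependent edge_rv d.

End RandomGraphs.

Section Densities.
Context (R : realType) (W : finType).
Implicit Types H F : sgraph W.

Definition Phi (n d : nat) (p : R) H : R :=
  \sum_(F : sgraph W | nonempty_sub H F)
    (20 * #|W|%:R / n%:R) ^+ #|endpoints F| *
    (d.+1%:R ^+ edge_cover_number F / p ^+ #|F|).

(* The ratios are nonnegative, so starting the maximum at 0 is harmless. *)
Definition max_density H : R :=
  \big[Num.max/0]_(F : sgraph W | nonempty_sub H F)
    (#|F|%:R / #|endpoints F|%:R).

End Densities.

(* Main.v *)
(* Second moment method, over the injections phi : W -> [n] that are "good":
   no two edges of phi(H) are adjacent in the dependency graph D.  A copy phi(H)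
   with phi good is present with probability p^|E(H)|, and d|E(H)||V(H)|/n < 0.9
   makes a positive fraction of all injections good.

   For good phi, psi let hits phi psi be the set of edges e of H such that
   phi(e) is equal or D-adjacent to some edge of psi(H).  Deleting these edges
   from phi(H) makes phi(H) and psi(H) jointly independent, so both copies are
   present with probability at most p^(2|E(H)| - |hits phi psi|), and exactly
   p^(2|E(H)|) if there are no hits.  By symmetry the pair may be charged to
   whichever of F = hits phi psi and F' = hits psi phi has fewer vertices, and
   it remains to bound, for each F, the number of pairs charged to F by
   (20|V(H)|/n)^|V(F)| (d+1)^f(F) times the number of all pairs.

   Each pair is revealed vertex by vertex, following a minimum edge cover of F.
   The cost of revealing the next cover edge e of F is the right one unless it
   has one new vertex while phi(e) touches an edge psi(f) all of whose vertices
   are already known; f then has up to f(F)|V(H)| candidates instead of |V(H)|.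
   Such losses, of a factor y = f(F) each, are paid for by exploring psi
   further: as |V(F')| >= |V(F)|, at least |V(F)| vertices of psi get known by
   scanning the at most (d+1)|E(H)| edges which are equal or D-adjacent to
   phi(F), and each of them is used to reveal vertices of psi with weight
   |V(H)|/n.  Giving every known vertex of psi the weight y turns this scan into
   a factor (1 + y |V(H)|/n)^((d+1)|E(H)|), which the hypothesis on d bounds by
   a constant to the power f(F). *)
Require Import Defs.
From HB Require Import structures.
From mathcomp Require Import all_boot all_order all_algebra perm.
From mathcomp Require Import lra ring zify.
Import Order.TTheory GRing.Theory Num.Theory.
Local Open Scope ring_scope.

(** * Conditional counts of injections with some vertices already revealed *)

Section Cylinders.
Local Open Scope set_scope.
Set Implicit Arguments.
Unset Strict Implicit.
Variables (R : realFieldType) (W V : finType).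
Implicit Types (U : {set W}) (al be phi psi : {ffun W -> V}).

Definition upd al w y : {ffun W -> V} :=
  [ffun z => if z == w then y else al z].

(** The partial assignment known so far is stored as a total function; only its values on [U]
    matter, and the cylinder is empty if these are not distinct. *)
Definition cyl U al : {set {ffun W -> V}} :=
  [set phi : {ffun W -> V} | injectiveb phi & [forall w in U, phi w == al w]].

Lemma cylP U al phi :
  reflect (injective phi /\ {in U, phi =1 al}) (phi \in cyl U al).
Proof.
rewrite inE; apply: (iffP andP) => -[injphi agree]; split.
- exact/injectiveP.
- by move=> w wU; apply/eqP; move/forall_inP: agree => /(_ w wU).
- exact/injectiveP.
- by apply/forall_inP => w wU; rewrite agree.
Qed.

Lemma cyl_upd U al w y : w \notin U ->
  cyl (w |: U) (upd al w y) = [set phi in cyl U al | phi w == y].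
Proof.
move=> wU; apply/setP => phi; rewrite inE.
apply/cylP/andP => [[injphi agree]|[/cylP[injphi agree] /eqP phiw]].
  split; last by rewrite (agree w) ?setU11// ffunE eqxx.
  apply/cylP; split=> // z zU; rewrite agree ?setU1r// ffunE.
  by case: eqP => // zw; rewrite -zw zU in wU.
split=> // z /setU1P[->|zU]; first by rewrite ffunE eqxx.
by rewrite ffunE; case: eqP => [->//|_]; rewrite agree.
Qed.

Lemma cyl_upd_id U al w : w \in U -> cyl (w |: U) (upd al w (al w)) = cyl U al.
Proof.
move=> wU; apply/setP => phi; have -> : w |: U = U by apply/setUidPr; rewrite sub1set.
by apply/cylP/cylP => -[injphi agree]; split=> // z zU; rewrite agree// ffunE;
   case: eqP => [->|].
Qed.

(** Swapping [y] with another value outside [al(U)] maps this cylinder injectively into another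
    slice of [cyl U al], and at least #|V| - #|W| values lie outside. So an unrevealed vertex takes
    a given value with conditional probability at most 1 / [gap]. *)
Lemma card_cyl_upd U al w y : w \notin U ->
  ((#|V| - #|W|) * #|cyl (w |: U) (upd al w y)| <= #|cyl U al|)%N.
Proof.
move=> wU; rewrite cyl_upd//.
pose A y := [set phi in cyl U al | phi w == y]; rewrite -/(A y).
have [->|[phi0]] := set_0Vmem (A y); first by rewrite cards0 muln0.
rewrite inE => /andP[/cylP[inj0 agree0] /eqP phi0w].
pose Y := ~: (al @: U).
have al_inj : {in U &, injective al}.
  by move=> a b aU bU; rewrite -!agree0// => /inj0.
have yY : y \in Y.
  rewrite inE; apply/imsetP => -[z zU yz].
  have /inj0 wz : phi0 w = phi0 z by rewrite phi0w yz agree0.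
  by rewrite wz zU in wU.
have leA y' : y' \in Y -> (#|A y| <= #|A y'|)%N.
  move=> y'Y; pose t phi : {ffun W -> V} := [ffun z => tperm y y' (phi z)].
  have t_inj : injective t.
    move=> p q pq; apply/ffunP => z; apply: (@perm_inj _ (tperm y y')).
    by move/ffunP: pq => /(_ z); rewrite !ffunE.
  rewrite -(card_imset _ t_inj); apply/subset_leq_card/subsetP => _ /imsetP[p pA ->].
  move: pA; rewrite !inE => /andP[/andP[/injectiveP injp /forall_inP agree] /eqP pw].
  rewrite ffunE pw tpermL eqxx andbT; apply/andP; split.
    by apply/injectiveP => a b; rewrite !ffunE => /perm_inj/injp.
  apply/forall_inP => z zU; rewrite ffunE (eqP (agree z zU)) tpermD //.
    by apply/eqP => ya; move: yY; rewrite inE ya imset_f.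
  by apply/eqP => ya; move: y'Y; rewrite inE ya imset_f.
have -> : #|cyl U al| = (\sum_y' #|A y'|)%N.
  rewrite -sum1_card (partition_big (fun phi => phi w) predT)//=.
  by apply: eq_bigr => y' _; rewrite -sum1_card; apply: eq_bigl => p; rewrite [RHS]inE.
rewrite (bigID (mem Y))/=; apply: leq_trans (leq_addr _ _).
apply: (@leq_trans (\sum_(y' in Y) #|A y|)%N); last by apply: leq_sum.
rewrite sum_nat_const leq_mul2r; apply/orP; right.
rewrite cardsCs setCK card_in_imset//.
by apply: leq_sub2l; apply: max_card.
Qed.

Hypothesis WV : (#|W| < #|V|)%N.

Let gap : R := (#|V| - #|W|)%N%:R.

Lemma gap_gt0 : 0 < gap.
Proof. by rewrite ltr0n subn_gt0. Qed.

Lemma card_cyl_upd_le U al w y : w \notin U ->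
  #|cyl (w |: U) (upd al w y)|%:R <= #|cyl U al|%:R / gap.
Proof.
by move=> wU; rewrite ler_pdivlMr ?gap_gt0// mulrC -natrM ler_nat card_cyl_upd.
Qed.

Lemma sum_cyl_partition (g : {ffun W -> V} -> R) U al w : w \notin U ->
  \sum_(phi in cyl U al) g phi =
  \sum_y \sum_(phi in cyl (w |: U) (upd al w y)) g phi.
Proof.
move=> wU; rewrite (partition_big (fun phi => phi w) predT)//=.
apply: eq_bigr => y _; apply: eq_bigl => phi.
by rewrite cyl_upd// [RHS]inE.
Qed.

Lemma sum_cyl_free (g : {ffun W -> V} -> R) U al w K :
  (forall y, \sum_(phi in cyl (w |: U) (upd al w y)) g phi
     <= K * #|cyl (w |: U) (upd al w y)|%:R) ->
  \sum_(phi in cyl U al) g phi <= K * #|cyl U al|%:R.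
Proof.
move=> le_K; have [wU|wU] := boolP (w \in U).
  by move: (le_K (al w)); rewrite cyl_upd_id.
have -> : #|cyl U al|%:R = \sum_(phi in cyl U al) (1 : R).
  by rewrite sumr_const.
rewrite !(sum_cyl_partition _ _ wU) mulr_sumr; apply: ler_sum => y _.
by rewrite sumr_const.
Qed.

Lemma sum_cyl_force (g : {ffun W -> V} -> R) U al w (Y : {set V}) K :
  w \notin U -> 0 <= K ->
  (forall phi, phi \in cyl U al -> phi w \notin Y -> g phi = 0) ->
  (forall y, y \in Y -> \sum_(phi in cyl (w |: U) (upd al w y)) g phi
     <= K * #|cyl (w |: U) (upd al w y)|%:R) ->
  \sum_(phi in cyl U al) g phi <= #|Y|%:R * K / gap * #|cyl U al|%:R.
Proof.
move=> wU K0 gY le_K; rewrite (sum_cyl_partition _ _ wU) (bigID (mem Y))/=.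
rewrite [X in _ + X]big1 ?addr0; last first.
  move=> y yY; apply: big1 => phi; rewrite cyl_upd// inE => /andP[phiC /eqP phiw].
  by apply: gY => //; rewrite phiw.
rewrite -!mulrA mulr_natl -sumr_const; apply: ler_sum => y yY.
apply: le_trans (le_K y yY) _; rewrite ler_wpM2l// mulrC.
exact: card_cyl_upd_le.
Qed.

(** The dual of forcing: the point [i] of [V] must be hit, and its preimage is guessed among at most
    #|W| vertices, each guess being right with probability at most 1 / [gap]. *)
Lemma sum_cyl_reveal (g : {ffun W -> V} -> R) U al i K :
  0 <= K -> (forall phi, phi \in cyl U al -> 0 <= g phi) ->
  (forall phi, phi \in cyl U al ->
     (forall w, w \notin U -> phi w <> i) -> g phi = 0) ->
  (forall w, w \notin U -> \sum_(phi in cyl (w |: U) (upd al w i)) g phi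
     <= K * #|cyl (w |: U) (upd al w i)|%:R) ->
  \sum_(phi in cyl U al) g phi <= #|W|%:R * K / gap * #|cyl U al|%:R.
Proof.
move=> K0 g0 gi h.
apply: (@le_trans _ _ (\sum_(w in ~: U)
    \sum_(phi in cyl (w |: U) (upd al w i)) g phi)).
  rewrite (eq_bigr (fun w => \sum_(phi in cyl U al | phi w == i) g phi)).
    rewrite (exchange_big_dep (mem (cyl U al)))/=; last by move=> w p _ /andP[].
    apply: ler_sum => phi phiC; have gphi := g0 _ phiC.
    have [/existsP[w /andP[wU phiw]]|] :=
      boolP [exists w, (w \in ~: U) && (phi w == i)].
      by rewrite (bigD1 w)/= ?wU ?phiC// lerDl sumr_ge0.
    rewrite negb_exists => /forallP no; rewrite gi ?sumr_ge0// => w wU phiw.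
    by move: (no w); rewrite inE wU phiw eqxx.
  move=> w; rewrite inE => wU; apply: eq_bigl => phi.
  by rewrite cyl_upd// inE.
apply: (@le_trans _ _ (\sum_(w in ~: U) (K * (#|cyl U al|%:R / gap)))).
  apply: ler_sum => w; rewrite inE => wU; apply: le_trans (h w wU) _.
  by rewrite ler_wpM2l// card_cyl_upd_le.
rewrite sumr_const -[leLHS]mulr_natl.
have -> : #|W|%:R * K / gap * #|cyl U al|%:R
    = #|W|%:R * (K * (#|cyl U al|%:R / gap)) by ring.
rewrite ler_wpM2r ?ler_nat ?max_card// mulr_ge0// divr_ge0//.
Qed.

(** A conditional probability bound, stated without division because either cylinder may be
    empty. *)
Definition pairs_le (P : {ffun W -> V} -> {ffun W -> V} -> bool) U al U' be K :=
  \sum_(phi in cyl U al) \sum_(psi in cyl U' be) (P phi psi)%:R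
    <= K * (#|cyl U al|%:R * #|cyl U' be|%:R) :> R.

Implicit Type P : {ffun W -> V} -> {ffun W -> V} -> bool.

Lemma pairs_leC P U al U' be K :
  pairs_le (fun phi psi => P psi phi) U' be U al K -> pairs_le P U al U' be K.
Proof. by rewrite /pairs_le exchange_big/= [_%:R * _]mulrC. Qed.

Lemma pairs_le_weak P U al U' be K K' :
  K <= K' -> pairs_le P U al U' be K -> pairs_le P U al U' be K'.
Proof.
by move=> le_K h; apply: le_trans h _; rewrite ler_wpM2r// mulr_ge0.
Qed.

Lemma pairs_le_sub P P' U al U' be K :
  (forall phi psi, phi \in cyl U al -> psi \in cyl U' be -> P phi psi ->
     P' phi psi) ->
  pairs_le P' U al U' be K -> pairs_le P U al U' be K.
Proof.
move=> PP'; apply: le_trans; apply: ler_sum => phi phiC.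
apply: ler_sum => psi psiC; rewrite ler_nat.
by case: (boolP (P _ _)) => // /(PP' _ _ phiC psiC) ->.
Qed.

Lemma pairs_le_freel P U al U' be w K :
  (forall y, pairs_le P (w |: U) (upd al w y) U' be K) -> pairs_le P U al U' be K.
Proof.
rewrite /pairs_le => h; rewrite [_%:R * _]mulrC mulrA.
by apply: sum_cyl_free => y; rewrite -mulrA [_%:R * _]mulrC.
Qed.

Lemma pairs_le_freer P U al U' be w K :
  (forall y, pairs_le P U al (w |: U') (upd be w y) K) -> pairs_le P U al U' be K.
Proof.
by move=> h; apply: pairs_leC; apply: pairs_le_freel => y; apply: pairs_leC.
Qed.

Lemma pairs_le_forcel P U al U' be w (Y : {set V}) K :
  w \notin U -> 0 <= K ->
  (forall phi psi, phi \in cyl U al -> psi \in cyl U' be -> P phi psi ->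
     phi w \in Y) ->
  (forall y, y \in Y -> pairs_le P (w |: U) (upd al w y) U' be K) ->
  pairs_le P U al U' be (#|Y|%:R * K / gap).
Proof.
rewrite /pairs_le => wU K0 PY h.
rewrite [_%:R * _%:R]mulrC mulrA.
have -> : #|Y|%:R * K / gap * #|cyl U' be|%:R
    = #|Y|%:R * (K * #|cyl U' be|%:R) / gap by ring.
apply: (sum_cyl_force wU); first by rewrite mulr_ge0.
  move=> phi phiC phiY; apply: big1 => psi psiC; case: (boolP (P phi psi)) => // Pp.
  by rewrite (PY _ _ phiC psiC Pp) in phiY.
by move=> y yY; rewrite -mulrA [X in _ * X]mulrC h.
Qed.

Lemma pairs_le_union (I : finType) (A : {set I})
    (Q : I -> {ffun W -> V} -> {ffun W -> V} -> bool) P U al U' be K :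
  (forall phi psi, phi \in cyl U al -> psi \in cyl U' be -> P phi psi ->
     exists2 i, i \in A & Q i phi psi) ->
  (forall i, i \in A -> pairs_le (Q i) U al U' be K) ->
  pairs_le P U al U' be (#|A|%:R * K).
Proof.
rewrite /pairs_le => PQ h; rewrite -mulrA mulr_natl -sumr_const.
apply: le_trans (ler_sum _ h).
rewrite [leRHS]exchange_big/=; apply: ler_sum => phi phiC.
rewrite [leRHS]exchange_big/=; apply: ler_sum => psi psiC.
case: (boolP (P phi psi)) => [Pp|_]; last by apply: sumr_ge0.
have [i iA Qi] := PQ _ _ phiC psiC Pp.
by rewrite (bigD1 i)//= Qi lerDl sumr_ge0.
Qed.

Lemma pairs_le_revealr P U al U' be i K :
  0 <= K ->
  (forall phi psi, phi \in cyl U al -> psi \in cyl U' be -> P phi psi ->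
     exists2 w, w \notin U' & psi w = i) ->
  (forall w, w \notin U' -> pairs_le P U al (w |: U') (upd be w i) K) ->
  pairs_le P U al U' be (#|W|%:R * K / gap).
Proof.
move=> K0 Pi h; apply: pairs_leC; rewrite /pairs_le [#|cyl U' be|%:R * _]mulrC mulrA.
have -> : #|W|%:R * K / gap * #|cyl U al|%:R =
    #|W|%:R * (K * #|cyl U al|%:R) / gap by ring.
apply: (@sum_cyl_reveal _ _ _ i); first by rewrite mulr_ge0.
- by move=> psi _; apply: sumr_ge0.
- move=> psi psiC nopsi; apply: big1 => phi phiC; case: (boolP (P _ _)) => // Pp.
  by have [w wU psiw] := Pi _ _ phiC psiC Pp; case: (nopsi w).
- move=> w wU; by rewrite -mulrA exchange_big/=; apply: h.
Qed.

Lemma pairs_le_or P Q1 Q2 U al U' be K1 K2 :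
  (forall phi psi, phi \in cyl U al -> psi \in cyl U' be -> P phi psi ->
     Q1 phi psi || Q2 phi psi) ->
  pairs_le Q1 U al U' be K1 -> pairs_le Q2 U al U' be K2 ->
  pairs_le P U al U' be (K1 + K2).
Proof.
rewrite /pairs_le mulrDl => PQ h1 h2; apply: le_trans (lerD h1 h2).
rewrite -big_split/=; apply: ler_sum => phi phiC.
rewrite -big_split/=; apply: ler_sum => psi psiC.
case: (boolP (P phi psi)) => [Pp|_]; last by rewrite addr_ge0.
by rewrite -natrD ler_nat; move: (PQ _ _ phiC psiC Pp); case: (Q1 _ _); case: (Q2 _ _).
Qed.

Lemma pairs_le_slice P U al U' be K :
  (forall phi, phi \in cyl U al ->
     \sum_(psi in cyl U' be) (P phi psi)%:R <= K * #|cyl U' be|%:R) ->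
  pairs_le P U al U' be K.
Proof.
move=> h; rewrite /pairs_le [_%:R * _]mulrC mulrA mulr_natr -sumr_const.
exact: ler_sum.
Qed.

End Cylinders.

(** * Scanning a list of vertex sets for vertices of psi *)

Section Exploration.
Local Open Scope set_scope.
Set Implicit Arguments.
Unset Strict Implicit.
Variables (R : realFieldType) (W V : finType).
Hypothesis WV : (#|W| < #|V|)%N.
Implicit Types (U e f : {set W}) (I : {set V}) (al be phi psi : {ffun W -> V}).

Let gap : R := (#|V| - #|W|)%N%:R.
Let theta : R := #|W|%:R / gap.
Variable y : R.
Hypotheses (y1 : 1 <= y) (thy1 : theta * y <= 1).

Let gap0 : 0 < gap. Proof. exact: gap_gt0. Qed.
Let theta0 : 0 <= theta. Proof. by rewrite divr_ge0// ltW. Qed.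
Let y0 : 0 < y. Proof. exact: lt_le_trans y1. Qed.
Let thy0 : 0 <= theta * y. Proof. by rewrite mulr_ge0// ltW. Qed.

(** Each [I] is only required to lie in the image of [psi], not to be the image of an edge, so that
    the condition can be revealed point by point. *)
Definition reach (Is : seq {set V}) psi : {set W} :=
  [set w | has (fun I => (psi w \in I) && (I \subset psi @: [set: W])) Is].

Lemma reach_known I Is U be psi : psi \in cyl U be -> I \subset be @: U ->
  U :|: reach (I :: Is) psi = U :|: reach Is psi.
Proof.
move=> /cylP[injpsi agree] IU; apply/setP => w; rewrite !inE /=.
case: (boolP (w \in U)) => //= wU; case: (boolP (psi w \in I)) => //= wI.
have /imsetP[z zU] := subsetP IU _ wI.
by rewrite -agree// => /injpsi wz; rewrite wz zU in wU.
Qed.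

(* Every vertex of psi revealed costs a factor theta and raises the potential
   y^|U| by a factor y. *)
Lemma reveal_le I Is U be v k B : (#|I :\: be @: U| <= k)%N -> 0 <= B ->
  (forall U be, \sum_(psi in cyl U be) (v <= #|U :|: reach Is psi|)%N%:R
     <= y ^+ #|U| * B * #|cyl U be|%:R) ->
  \sum_(psi in cyl U be)
      ((I \subset psi @: [set: W]) && (v <= #|U :|: reach (I :: Is) psi|)%N)%:R
    <= (theta * y) ^+ #|I :\: be @: U| * y ^+ #|U| * B * #|cyl U be|%:R.
Proof.
move=> + B0 hIs; elim: k U be => [|k IHk] U be kI.
  have IU : I \subset be @: U by rewrite -setD_eq0 -cards_eq0 -leqn0.
  have /eqP -> : #|I :\: be @: U| == 0%N by rewrite -leqn0.
  rewrite expr0 mul1r; apply: le_trans (hIs U be); apply: ler_sum => psi psiC.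
  by rewrite (reach_known _ psiC)// ler_nat; case: (_ \subset _).
have [I0|[i iI]] := set_0Vmem (I :\: be @: U).
  by apply: IHk; rewrite I0 cards0.
have [iNU iII] : i \notin be @: U /\ i \in I by move: iI; rewrite inE => /andP[].
set c := #|_ :\: _|; have c0 : (0 < c)%N by apply/card_gt0P; exists i.
have -> : (theta * y) ^+ c * y ^+ #|U| * B * #|cyl U be|%:R =
  #|W|%:R * ((theta * y) ^+ c.-1 * y ^+ #|U|.+1 * B) / gap * #|cyl U be|%:R.
  by rewrite -[in LHS](prednK c0) !exprS /theta; ring.
apply: (sum_cyl_reveal WV (i := i)).
- by rewrite !mulr_ge0 ?exprn_ge0// ltW.
- by move=> psi _; apply: ler0n.
- move=> psi /cylP[injpsi agree] noi; case: (boolP (I \subset _)) => //= Isub.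
  have /imsetP[w _ iw] := subsetP Isub _ iII.
  case: (boolP (w \in U)) => [wU|/noi]; last by rewrite -iw.
  by move: iNU; rewrite iw agree// imset_f.
move=> w wU.
have imU : upd be w i @: (w |: U) = i |: be @: U.
  rewrite imsetU1 ffunE eqxx; congr (_ |: _); apply: eq_in_imset => z zU.
  by rewrite ffunE; case: eqP => // zw; rewrite -zw zU in wU.
have cE : #|I :\: upd be w i @: (w |: U)| = c.-1.
  rewrite imU /c (cardsD1 i (I :\: be @: U)) iI add1n /=.
  by congr #|pred_of_set _|; apply/setP => z; rewrite !inE negb_or andbA.
have kc : (c.-1 <= k)%N by rewrite -ltnS prednK.
have := IHk (w |: U) (upd be w i); rewrite cE => /(_ kc).
rewrite cardsU1 wU add1n; apply: le_trans.
apply: ler_sum => psi _; rewrite ler_nat; case: (_ \subset _) => //=.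
case: (boolP (v <= #|U :|: _|)%N) => // vle.
suff -> : (v <= #|w |: U :|: reach (I :: Is) psi|)%N by [].
apply: leq_trans vle _; apply/subset_leq_card/setSU/subsetUr.
Qed.

(* The edges of Is are inspected one by one: either the edge is not in the image
   of psi, or it is already known, or it reveals a vertex, at cost theta * y. *)
Lemma scan_le (Is : seq {set V}) U be v :
  \sum_(psi in cyl U be) (v <= #|U :|: reach Is psi|)%N%:R
    <= y ^+ #|U| * ((1 + theta * y) ^+ size Is / y ^+ v) * #|cyl U be|%:R.
Proof.
elim: Is U be => [|I Is IH] U be /=.
  (* With nothing left to scan, the indicator of v <= #|U| is at most y^#|U| / y^v, as y >= 1. *)
  rewrite expr0 div1r (eq_bigr (fun=> (v <= #|U|)%N%:R)); last first.
    move=> psi _; congr (_ <= #|pred_of_set _|)%N%:R.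
    by apply/setP => w; rewrite !inE orbF.
  rewrite sumr_const -[leLHS]mulr_natr ler_wpM2r//.
  case: leqP => [vU|_]; last by rewrite mulr_ge0 ?invr_ge0 ?exprn_ge0 ?(ltW y0).
  by rewrite ler_pdivlMr ?exprn_gt0// mul1r ler_weXn2l.
set B := (1 + theta * y) ^+ size Is / y ^+ v.
have B0 : 0 <= B by rewrite divr_ge0 ?exprn_ge0 ?addr_ge0// ltW.
have RHS : y ^+ #|U| * ((1 + theta * y) ^+ (size Is).+1 / y ^+ v) * #|cyl U be|%:R
  = y ^+ #|U| * B * #|cyl U be|%:R
    + theta * y * y ^+ #|U| * B * #|cyl U be|%:R.
  by rewrite /B exprS; ring.
have pos : 0 <= y ^+ #|U| * B * #|cyl U be|%:R.
  by apply: mulr_ge0 => //; apply: mulr_ge0 => //; apply/exprn_ge0/ltW.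
rewrite RHS; have [IU|IU] := boolP (I \subset be @: U).
  apply: le_trans (_ : y ^+ #|U| * B * #|cyl U be|%:R <= _).
    apply: le_trans (IH U be); apply: ler_sum => psi psiC.
    by rewrite (reach_known _ psiC).
  by rewrite lerDl -2![theta * y * _ * _]mulrA mulr_ge0.
have IH2 := reveal_le (leqnn _) B0 IH.
apply: le_trans (lerD (IH U be) (le_trans (IH2 I U be) _)); last first.
  rewrite ler_wpM2r// ler_wpM2r// ler_wpM2r ?exprn_ge0 ?(ltW y0)//.
  (* Several new points in [I] cost a power of theta * y, which is at most theta * y by [thy1]. *)
  rewrite -[leRHS]expr1 ler_wiXn2l//.
  by rewrite card_gt0 setD_eq0.
rewrite -big_split/=; apply: ler_sum => psi psiC.
rewrite -natrD ler_nat; case: (boolP (I \subset _)) => [_|NI] /=.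
  exact: leq_addl.
rewrite addn0.
suff -> : reach (I :: Is) psi = reach Is psi by [].
by apply/setP => w; rewrite !inE /= (negbTE NI) andbF.
Qed.
End Exploration.

(** * Revealing both injections along a list of edges *)

Section Tracking.
Local Open Scope set_scope.
Set Implicit Arguments.
Unset Strict Implicit.

Lemma card_unordered_pairs (V : finType) (I : {set V}) :
  (#|[set q : V * V | [set q.1; q.2] == I]| <= 2)%N.
Proof.
have [->|[[a b]]] := set_0Vmem [set q : V * V | [set q.1; q.2] == I].
  by rewrite cards0.
rewrite inE /= => /eqP <-.
apply: (@leq_trans #|[set (a, b); (b, a)]|); last first.
  by rewrite cards2; case: (_ != _).
apply/subset_leq_card/subsetP => -[c d]; rewrite !inE /= => /eqP/setP cd.
move: (cd a) (cd b) (cd c) (cd d); rewrite !inE !eqxx !orbT /= !xpair_eqE.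
rewrite (eq_sym a c) (eq_sym a d) (eq_sym b c) (eq_sym b d).
by case: (c == a); case: (c == b); case: (d == a); case: (d == b).
Qed.

Lemma card_edges_in (W : finType) (H : {set {set W}}) (U : {set W}) :
  {in H, forall f : {set W}, #|f| = 2} ->
  (#|[set f in H | f \subset U]|.*2 <= #|U| * #|U|.-1)%N.
Proof.
move=> H2; rewrite -[X in (_ <= _ * X)%N]bin1 mul_bin_diag -cards_draws mul2n leq_double.
apply/subset_leq_card/subsetP => f; rewrite !inE => /andP[fH ->].
by rewrite H2.
Qed.

Variables (R : realFieldType) (W V : finType).
Hypothesis WV : (#|W| < #|V|)%N.
Implicit Types (U e f : {set W}) (I : {set V}) (al be phi psi : {ffun W -> V}).

Let gap : R := (#|V| - #|W|)%N%:R.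
Let theta : R := #|W|%:R / gap.
Let gap0 : 0 < gap. Proof. exact: gap_gt0. Qed.
Let theta0 : 0 <= theta. Proof. by rewrite divr_ge0// ltW. Qed.

(** Edges are handled as plain vertex sets here. Later [nb] becomes the closed neighbourhood
    relation of the dependency graph, with [Delta] = d + 1. *)
Variables (H : {set {set W}}) (nb : rel {set V}) (Delta : nat).
Hypothesis H2 : {in H, forall f : {set W}, #|f| = 2}.
Hypothesis nbC : symmetric nb.
Hypothesis nb_deg : forall S, (#|[set T | nb S T]| <= Delta)%N.

Variable k : nat.
Hypothesis k0 : (0 < k)%N.
Let y : R := k%:R.
Let y1 : 1 <= y. Proof. by rewrite ler1n. Qed.
Let y0 : 0 < y. Proof. by rewrite ltr0n. Qed.

(* Every edge of L has a vertex outside U and all preceding edges of L. *)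
Fixpoint fresh U (L : seq {set W}) : bool :=
  if L is e :: L' then [&& #|e| == 2, ~~ (e \subset U) & fresh (e :|: U) L']
  else true.

Fixpoint gain U (L : seq {set W}) : nat :=
  if L is e :: L' then (#|e :\: U| + gain (e :|: U) L')%N else 0%N.

Definition touched phi psi (L : seq {set W}) : bool :=
  all (fun e => [exists f in H, nb (phi @: e) (psi @: f)]) L.

(** [Q] is the event examined once all of [L] has been tracked; its bound pays a weight y for every
    vertex of psi known by then. *)
Variable (Q : {ffun W -> V} -> {ffun W -> V} -> bool) (T : R).
Hypothesis T0 : 0 <= T.
Hypothesis QT : forall U al U' be, pairs_le Q U al U' be (y ^+ #|U'| * T).

(* An edge of L with a new vertices contributes 2 Delta (theta y) if a = 1 (two
   cases) and Delta (theta y)^2 if a = 2, i.e. 4 Delta (theta y / 2)^a. *)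
Let cost U (L : seq {set W}) c : R :=
  (4 * Delta%:R) ^+ size L * (theta * y / 2) ^+ gain U L * y ^+ c * T.

Let cost_ge0 U L c : 0 <= cost U L c.
Proof.
by rewrite /cost !mulr_ge0 ?exprn_ge0 ?mulr_ge0 ?invr_ge0 ?(ltW y0).
Qed.

Let tracked L phi psi := touched phi psi L && Q phi psi.

Lemma fresh_one_new e U : #|e| = 2 -> #|e :\: U| = 1%N ->
  exists c w, [/\ e = [set c; w], c \in U, w \notin U & c != w].
Proof.
move=> e2 /eqP/cards1P[w ew].
have we : w \in e by have := set11 w; rewrite -ew inE => /andP[].
have wU : w \notin U by have := set11 w; rewrite -ew inE => /andP[].
have : #|e :\ w| = 1%N by have := cardsD1 w e; rewrite we e2 => -[].
move=> /eqP/cards1P[c ec].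
have [cw ce] : c != w /\ c \in e by have := set11 c; rewrite -ec !inE => /andP[].
exists c, w; split=> //.
  apply/setP => z; rewrite !inE; case: (eqVneq z w) => [->|zw]; first by rewrite orbT.
  by have := in_set1 z c; rewrite -ec !inE zw /= orbF.
by apply/negP => /negP cU; have := in_set1 c w; rewrite -ew !inE cU ce (negbTE cw).
Qed.

Lemma cost_one e U L c : #|e :\: U| = 1%N ->
  cost U (e :: L) c = 2 * Delta%:R * theta * y * cost (e :|: U) L c.
Proof. by move=> e1; rewrite /cost /= e1 add1n !exprS; field. Qed.

Lemma cost_two e U L c : #|e :\: U| = 2%N ->
  cost U (e :: L) c = Delta%:R * theta ^+ 2 * y ^+ 2 * cost (e :|: U) L c.
Proof. by move=> e1; rewrite /cost /= e1 exprS exprD; field. Qed.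

(* If e has a single new vertex w, either e meets an f inside U', and then
   psi f is known and forces phi w, or phi w is free and e reveals a vertex of psi.
   If both vertices of e are new, psi f is chosen freely and forces phi e. *)
Lemma tracked_le L U al U' be : fresh U L -> (#|U'| + (size L).*2 <= k.*2)%N ->
  pairs_le (tracked L) U al U' be (cost U L #|U'|).
Proof.
elim: L U al U' be => [|e L IH] U al U' be /=.
  move=> _ _; rewrite /cost /= !expr0 !mul1r.
  by apply: pairs_le_sub (QT U al U' be) => phi psi _ _ /andP[].
move=> /and3P[/eqP e2 eU freshL] sizeU'.
have sub_tracked phi psi : tracked (e :: L) phi psi -> tracked L phi psi.
  by rewrite /tracked /= => /andP[/andP[_ ->] ->].
have : (0 < #|e :\: U| <= 2)%N.
  rewrite card_gt0 setD_eq0 eU -[X in (_ <= X)%N]e2.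
  by rewrite subset_leq_card// subsetDl.
case E : #|e :\: U| => [|[|[|//]]] // _.
- have [c [w [eE cU wU cw]]] := fresh_one_new e2 E.
  have eUE : e :|: U = w |: U.
    have cUE : [set c] :|: U = U by apply/setUidPr; rewrite sub1set.
    by rewrite eE (setUC [set c]) -setUA cUE.
  rewrite cost_one//; have K0 := cost_ge0 (e :|: U) L #|U'|.
  set K := cost _ _ _ in K0 *.
  have DK0 : 0 <= Delta%:R * K / gap.
    by apply: divr_ge0; [apply: mulr_ge0|exact: ltW].
  have yK0 : 0 <= y * K by apply: mulr_ge0 => //; exact: ltW.
  have WK0 : 0 <= #|W|%:R * (y * K) / gap.
    by apply: divr_ge0; [apply: mulr_ge0|exact: ltW].
  (* The two summands: at most k * #|W| known edges f, each leaving [Delta] values for phi w; or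
     [Delta] sets near phi(e), a point of which is pulled back to a new vertex of psi, raising the
     weight by y. *)
  have -> : 2 * Delta%:R * theta * y * K =
    (k * #|W|)%:R * (Delta%:R * K / gap)
    + Delta%:R * (#|W|%:R * (y * K) / gap).
    by rewrite natrM /theta; field; rewrite gt_eqF.
  have phie phi : phi \in cyl U al -> phi @: e = [set al c; phi w].
    by move=> /cylP[_ agree]; rewrite eE imsetU1 imset_set1 agree.
  apply: (@pairs_le_or _ _ _ _
    (fun phi psi => tracked L phi psi &&
      [exists f in H, (f \subset U') && nb (phi @: e) (psi @: f)])
    (fun phi psi => tracked L phi psi &&
      [exists f in H, ~~ (f \subset U') && nb (phi @: e) (psi @: f)])).
  + move=> phi psi _ _ tr; rewrite sub_tracked//=; move: tr.
    rewrite /tracked /= => /andP[/andP[/exists_inP[f fH near] _] _].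
    case: (boolP (f \subset U')) => fU; apply/orP; [left|right];
      by apply/exists_inP; exists f => //; rewrite fU.
  + pose A1 := [set f in H | f \subset U'].
    apply: (@pairs_le_weak _ _ _ _ _ _ _ _ (#|A1|%:R * (Delta%:R * K / gap))).
      rewrite ler_wpM2r// ler_nat.
      (* Here #|U'| <= 2k, so at most #|U'| * #|W| / 2 <= k * #|W| edges of [H] lie inside [U']. *)
      rewrite -leq_double; apply: leq_trans (card_edges_in _ H2) _.
      rewrite -muln2 mulnAC muln2; apply: leq_mul.
        by apply: leq_trans sizeU'; apply: leq_addr.
      by apply: leq_trans (leq_pred _) _; apply: max_card.
    apply: (@pairs_le_union _ _ _ _ _
      (fun f phi psi => tracked L phi psi && nb (phi @: e) (psi @: f))).
      move=> phi psi _ _ /andP[-> /exists_inP[f fH /andP[fU near]]].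
      by exists f; rewrite ?inE ?fH.
    move=> f; rewrite inE => /andP[fH fU].
    pose Y := [set v | nb [set al c; v] (be @: f)].
    apply: (@pairs_le_weak _ _ _ _ _ _ _ _ (#|Y|%:R * K / gap)).
      rewrite ler_wpM2r ?invr_ge0 ?(ltW gap0)// ler_wpM2r// ler_nat.
      apply: leq_trans (nb_deg (be @: f)).
      have inj2 : injective (fun v => [set al c; v]).
        move=> a b /setP ab; have := ab a; have := ab b.
        rewrite !inE !eqxx !orbT => /orP[/eqP ->|/eqP //].
        by move=> /esym; rewrite orbb => /eqP.
      rewrite -(card_imset _ inj2); apply/subset_leq_card/subsetP => _ /imsetP[v vY ->].
      by move: vY; rewrite !inE nbC.
    apply: (pairs_le_forcel WV wU K0).
      move=> phi psi phiC /cylP[_ agree] /andP[_].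
      rewrite phie// inE.
      suff -> : psi @: f = be @: f by [].
      by apply: eq_in_imset => z zf; rewrite agree// (subsetP fU).
    move=> v _; rewrite -eUE.
    apply: pairs_le_sub (IH (e :|: U) (upd al w v) U' be freshL _).
      by move=> phi psi _ _ /andP[].
    by apply: leq_trans sizeU'; rewrite leq_add2l leq_double.
  + apply: (pairs_le_freel (w := w)) => v.
    pose A2 := [set I | nb [set al c; v] I].
    apply: (@pairs_le_weak _ _ _ _ _ _ _ _ (#|A2|%:R * (#|W|%:R * (y * K) / gap))).
      by rewrite ler_wpM2r// ler_nat nb_deg.
    apply: (@pairs_le_union _ _ _ _ _
      (fun I phi psi => tracked L phi psi &&
         [exists f in H, ~~ (f \subset U') && (psi @: f == I)])).
      move=> phi psi phiC _ /andP[-> /exists_inP[f fH /andP[fU near]]].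
      exists (psi @: f); last by apply/exists_inP; exists f; rewrite ?fU /=.
      move: phiC; rewrite cyl_upd// inE => /andP[/phie phiE /eqP phiw].
      by rewrite inE -phiw -phiE.
    (* If all points of [I] have known preimages, injectivity puts f inside [U'], a contradiction;
       otherwise a single unknown point is revealed, even if f has two. *)
    move=> I _; have [I0|[i]] := set_0Vmem (I :\: be @: U').
      apply: (@pairs_le_weak _ _ _ _ _ _ _ _ 0).
        exact: WK0.
      rewrite /pairs_le mul0r big1// => phi _; apply: big1 => psi psiC.
      case: (boolP (_ && _)) => // /andP[_ /exists_inP[f _ /andP[fU /eqP fI]]].
      case/negP: fU; apply/subsetP => z zf; case/cylP: psiC => injpsi agree.
      have : psi z \in be @: U'.
        have /eqP := I0; rewrite setD_eq0 => /subsetP; apply.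
        by rewrite -fI imset_f.
      by case/imsetP => z' z'U; rewrite -agree// => /injpsi ->.
    rewrite inE => /andP[iU iI].
    apply: (pairs_le_revealr WV (i := i)).
    * exact: yK0.
    * move=> phi psi _ /cylP[_ agree] /andP[_ /exists_inP[f _ /andP[_ /eqP fI]]].
      move: iI; rewrite -fI => /imsetP[z zf iz]; exists z => //.
      by apply/negP => zU; case/negP: iU; rewrite iz agree// imset_f.
    move=> w' w'U; rewrite -eUE.
    have -> : y * K = cost (e :|: U) L #|w' |: U'|.
      by rewrite /K /cost cardsU1 w'U add1n exprS; ring.
    apply: pairs_le_sub (IH (e :|: U) (upd al w v) (w' |: U') _ freshL _).
      by move=> phi psi _ _ /andP[].
    rewrite cardsU1 w'U; apply: leq_trans sizeU'.
    by rewrite doubleS !addnS addSn ltnS leqW.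
- have /eqP/cards2P[u [w [uw eE]]] := e2.
  have eNU : [disjoint e & U].
    rewrite -setI_eq0 -cards_eq0; move: E; rewrite cardsD e2.
    have : (#|e :&: U| <= 2)%N.
      by apply: leq_trans (subset_leq_card (subsetIl _ _)) _; rewrite e2.
    by case: #|_| => [|[|[|]]].
  have uU : u \notin U by rewrite (disjointFr eNU)// eE !inE eqxx.
  have wU : w \notin u |: U.
    by rewrite !inE eq_sym (negbTE uw) (disjointFr eNU)// eE !inE eqxx orbT.
  have eUE : e :|: U = w |: (u |: U) by rewrite eE setUA [[set w] :|: _]setUC.
  rewrite cost_two//; have K0 := cost_ge0 (e :|: U) L #|U'|.
  set K := cost _ _ _ in K0 *.
  have [K2 K2E] : exists K2, K2 = y ^+ 2 * K by eexists.
  have K20 : 0 <= K2 by rewrite K2E; apply: mulr_ge0 => //; apply/exprn_ge0/ltW.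
  (* There are #|H| <= #|W|^2 / 2 choices of f, whose vertices are revealed freely at weight y^2;
     then (phi u, phi w) is one of at most 2 * Delta ordered pairs, at cost 1 / gap^2. *)
  apply: (@pairs_le_weak _ _ _ _ _ _ _ _
    (#|H|%:R * ((Delta * 2)%:R * (1 * (1 * K2 / gap) / gap)))).
    have -> : #|H|%:R * ((Delta * 2)%:R * (1 * (1 * K2 / gap) / gap)) =
      (#|H|.*2)%:R * (Delta%:R * K2 / gap ^+ 2).
      by rewrite -muln2 !natrM; field; rewrite gt_eqF.
    have -> : Delta%:R * theta ^+ 2 * y ^+ 2 * K =
      (#|W| * #|W|)%:R * (Delta%:R * K2 / gap ^+ 2).
      by rewrite /theta K2E natrM; field; rewrite gt_eqF.
    rewrite ler_wpM2r ?divr_ge0 ?mulr_ge0 ?exprn_ge0 ?(ltW gap0)// ler_nat.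
    have := card_edges_in [set: W] H2.
    have -> : [set f in H | f \subset [set: W]] = H.
      by apply/setP => f; rewrite inE subsetT andbT.
    move=> /leq_trans; apply; rewrite cardsT leq_mul2l leq_pred orbT//.
  apply: (@pairs_le_union _ _ _ _ _
      (fun f phi psi => tracked L phi psi && nb (phi @: e) (psi @: f))).
    move=> phi psi _ _ tr; move: (tr); rewrite /tracked /= -/(touched _ _ _).
    move=> /andP[/andP[/exists_inP[f fH near] tL] q].
    by exists f => //; rewrite near tL q.
  move=> f fH; have /eqP/cards2P[a [b [ab fE]]] := H2 fH.
  apply: (pairs_le_freer (w := a)) => v1; apply: (pairs_le_freer (w := b)) => v2.
  set be2 := upd _ b v2; set U2 := b |: _.
  pose Y := [set q : V * V | nb [set q.1; q.2] (be2 @: f)].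
  apply: (@pairs_le_weak _ _ _ _ _ _ _ _ (#|Y|%:R * (1 * (1 * K2 / gap) / gap))).
    rewrite ler_wpM2r ?divr_ge0 ?mulr_ge0 ?invr_ge0 ?(ltW gap0)// ler_nat.
    apply: (@leq_trans (#|[set I | nb (be2 @: f) I]| * 2)); last first.
      by rewrite leq_mul2r nb_deg.
    rewrite -sum_nat_const -sum1_card.
    rewrite (partition_big (fun q : V * V => [set q.1; q.2])
        (mem [set I | nb (be2 @: f) I]))/=; last first.
      by move=> q; rewrite !inE nbC.
    apply: leq_sum => I _; rewrite sum1_card.
    apply: leq_trans (card_unordered_pairs I); apply/subset_leq_card/subsetP => q.
    by rewrite !inE => /andP[].
  apply: (@pairs_le_union _ _ _ _ _
      (fun q phi psi => [&& tracked L phi psi, phi u == q.1 & phi w == q.2])).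
    move=> phi psi _ /cylP[_ agree] /andP[-> near]; exists (phi u, phi w) => /=.
      rewrite inE /=; move: near; rewrite {1}eE imsetU1 imset_set1.
      suff -> : psi @: f = be2 @: f by [].
      by apply: eq_in_imset => z; rewrite fE !inE => zab; rewrite agree// !inE orbA
         [(z == b) || _]orbC zab.
    by rewrite !eqxx.
  move=> q _; have -> : 1 = #|[set q.1]|%:R :> R by rewrite cards1.
  apply: (pairs_le_forcel WV uU).
  + by rewrite divr_ge0 ?mulr_ge0 ?(ltW gap0).
  + by move=> phi psi _ _ /and3P[_ /eqP -> _]; rewrite inE.
  move=> v /set1P ->; have -> : #|[set q.1]|%:R = #|[set q.2]|%:R :> R by rewrite !cards1.
  apply: (pairs_le_forcel WV wU) => //.
  + by move=> phi psi _ _ /and3P[_ _ /eqP ->]; rewrite inE.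
  move=> v' _; rewrite -eUE.
  (* Vertices of f may be known already, so [U2] gains at most two; y >= 1 absorbs the
     difference. *)
  have U2le : (#|U2| <= #|U'| + 2)%N.
    rewrite /U2 !cardsU1 addnC [(_ + #|U'|)%N]addnC -addnA leq_add2l.
    by case: (_ \notin _); case: (_ \notin _).
  apply: (@pairs_le_weak _ _ _ _ _ _ _ _ (cost (e :|: U) L #|U2|)).
    rewrite K2E /K /cost mulrA [y ^+ 2 * _]mulrCA -exprD.
    rewrite ler_wpM2r// ler_wpM2l//.
      by rewrite mulr_ge0 ?exprn_ge0 ?mulr_ge0 ?invr_ge0 ?(ltW y0).
    by rewrite ler_weXn2l// addnC.
  apply: pairs_le_sub (IH (e :|: U) _ U2 be2 freshL _).
    by move=> phi psi _ _ /and3P[].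
  by apply: leq_trans sizeU'; rewrite doubleS -addn2 addnA addnAC leq_add2r.
Qed.

End Tracking.

(** * Minimum edge covers as exploration orders *)

Section EdgeCovers.
Local Open Scope set_scope.
Set Implicit Arguments.
Unset Strict Implicit.
Variable W : finType.
Implicit Types (F A : sgraph W) (L : seq {set W}) (U : {set W}).

Lemma card_pedge (e : pedge W) : #|val e| = 2.
Proof. exact/eqP/(valP e). Qed.

Lemma gainE U L : gain U L = #|(\bigcup_(e <- L) e) :\: U|.
Proof.
elim: L U => [|e L IH] U /=; first by rewrite big_nil set0D cards0.
rewrite IH big_cons setDUl -setDDl.
set B := \bigcup_(_ <- _) _.
have -> : e :\: U :|: B :\: U = (e :\: U) :|: (B :\: e :\: U).
  by apply/setP => z; rewrite !inE; case: (z \in e); case: (z \in U); case: (z \in B).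
rewrite cardsU; have -> : (e :\: U) :&: (B :\: e :\: U) = set0.
  by apply/setP => z; rewrite !inE; case: (z \in e); rewrite ?andbF.
by rewrite cards0 subn0.
Qed.

(** A private vertex lies in no earlier edge of the list, whatever the order. *)
Lemma fresh_private U L : uniq L ->
  {in L, forall e : {set W}, #|e| = 2} ->
  {in L, forall e : {set W}, exists2 x, x \in e :\: U &
     {in L, forall e' : {set W}, e' != e -> x \notin e'}} ->
  fresh U L.
Proof.
elim: L U => [|e L IH] U //= /andP[eL uL] L2 priv.
apply/and3P; split; first by rewrite L2 ?mem_head.
  have [x xe _] := priv e (mem_head _ _).
  by move: xe; rewrite inE => /andP[xU xe]; apply/subsetPn; exists x.
apply: IH => //; first by move=> e' e'L; rewrite L2 ?inE ?e'L ?orbT.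
move=> e' e'L; have [|x xe' xpriv] := priv e'; first by rewrite inE e'L orbT.
exists x; last by move=> e'' e''L; apply: xpriv; rewrite inE e''L orbT.
move: xe'; rewrite !inE negb_or => /andP[-> ->]; rewrite !andbT.
apply: xpriv; first exact: mem_head.
by apply: contraNneq eL => ->.
Qed.

Lemma size_le_gain U L : fresh U L -> (size L <= gain U L)%N.
Proof.
elim: L U => [|e L IH] U //= /and3P[_ eU fL].
by rewrite -add1n leq_add ?IH// card_gt0 setD_eq0.
Qed.

(** The first edge brings two new vertices, every later one at least one. *)
Lemma size_lt_gain L : L != [::] -> fresh set0 L -> (size L < gain set0 L)%N.
Proof.
case: L => [|e L] //= _ /and3P[/eqP e2 _ fL].
by rewrite setD0 e2 add2n !ltnS size_le_gain.
Qed.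

Lemma edge_cover_refl F : edge_cover F F.
Proof.
rewrite /edge_cover subxx; apply/forall_inP => x /bigcupP[e eF xe].
by apply/exists_inP; exists e.
Qed.

(** An edge of a minimum cover all of whose vertices were covered by other edges could be removed,
    so each edge has a private vertex. *)
Lemma min_edge_cover F : exists A,
  [/\ A \subset F, #|A| = edge_cover_number F, endpoints A = endpoints F
    & forall e, e \in A -> exists2 x, x \in val e &
        forall e', e' \in A -> e' != e -> x \notin val e'].
Proof.
rewrite /edge_cover_number; case: arg_minnP => [|A covA minA].
  exact: edge_cover_refl.
case/andP: (covA) => AF /forall_inP covers.
exists A; split=> //.
  apply/eqP; rewrite eqEsubset; apply/andP; split.
    apply/subsetP => x /bigcupP[e eA xe].
    by apply/bigcupP; exists e => //; exact: (subsetP AF).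
  apply/subsetP => x /covers /exists_inP[e eA xe].
  by apply/bigcupP; exists e.
move=> e eA.
have [/exists_inP[x xe /forall_inP priv]|] := boolP [exists x in val e,
    [forall e' in A, (e' != e) ==> (x \notin val e')]].
  by exists x => // e' e'A e'e; have /implyP := priv e' e'A; apply.
rewrite negb_exists_in => /forall_inP nopriv.
suff /minA : edge_cover F (A :\ e) by rewrite (cardsD1 e A) eA ltnn.
apply/andP; split; first by apply: subset_trans AF; apply: subD1set.
apply/forall_inP => x xF; have /exists_inP[e1 e1A xe1] := covers x xF.
have [e1e|e1e] := eqVneq e1 e; last first.
  by apply/exists_inP; exists e1; rewrite // !inE e1e.
rewrite e1e in xe1; have := nopriv x xe1; rewrite negb_forall_in.
case/exists_inP => e2 e2A; rewrite negb_imply negbK => /andP[e2e xe2].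
by apply/exists_inP; exists e2; rewrite // !inE e2e.
Qed.

Lemma edge_cover_list F : exists L : seq {set W},
  [/\ fresh set0 L, size L = edge_cover_number F,
      gain set0 L = #|endpoints F|
    & {in L, forall e : {set W}, exists2 e', e' \in F & e = val e'}].
Proof.
have [A [AF cA AE priv]] := min_edge_cover F.
pose L := [seq val e | e <- enum A].
have memL e : e \in L -> exists2 e', e' \in A & e = val e'.
  by case/mapP => e'; rewrite mem_enum => e'A ->; exists e'.
exists L; split.
- apply: fresh_private.
  + by rewrite map_inj_uniq ?enum_uniq//; apply: val_inj.
  + by move=> e /memL[e' _ ->]; rewrite card_pedge.
  move=> _ /memL[e eA ->]; have [x xe priv_x] := priv e eA.
  exists x; first by rewrite setD0.
  by move=> _ /memL[e' e'A ->] e'e; apply: priv_x.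
- by rewrite size_map -cardE.
- by rewrite gainE setD0 -AE /endpoints big_map big_enum.
by move=> e /memL[e' e'A ->]; exists e' => //; apply: (subsetP AF).
Qed.

Lemma endpoints_neq0 F : F != set0 -> endpoints F != set0.
Proof.
case/set0Pn => e eF; have : val e != set0 by rewrite -card_gt0 card_pedge.
case/set0Pn => x xe; apply/set0Pn; exists x.
by apply/bigcupP; exists e.
Qed.

Lemma edge_cover_number_lt F : F != set0 ->
  (0 < edge_cover_number F < #|endpoints F|)%N.
Proof.
move=> /endpoints_neq0 F0; have [L [fL <- gL _]] := edge_cover_list F.
have L0 : L != [::].
  by apply: contraNneq F0 => L0; rewrite -cards_eq0 -gL L0.
by rewrite -gL size_lt_gain// andbT lt0n size_eq0.
Qed.

Lemma edge_cover_number_le F : (edge_cover_number F <= #|F|)%N.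
Proof.
by have [A [AF <- _ _]] := min_edge_cover F; exact: subset_leq_card.
Qed.

End EdgeCovers.

(** * Counting the pairs charged to a subgraph *)

Section PairCount.
Local Open Scope set_scope.
Set Implicit Arguments.
Unset Strict Implicit.
Variables (R : realFieldType) (W V : finType).
Hypothesis WV : (#|W| < #|V|)%N.
Variables (H : sgraph W) (nb : rel {set V}).
Hypothesis nbC : symmetric nb.
Implicit Types (phi psi : {ffun W -> V}) (F : sgraph W).

Let gap : R := (#|V| - #|W|)%N%:R.
Let theta : R := #|W|%:R / gap.

Definition hits phi psi : sgraph W :=
  [set e in H | [exists f in H, nb (phi @: val e) (psi @: val f)]].

Definition injs : {set {ffun W -> V}} := [set phi : {ffun W -> V} | injectiveb phi].

Lemma cyl0 al : cyl set0 al = injs.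
Proof.
apply/setP => phi; rewrite !inE; case: (injectiveb _) => //=.
by apply/forall_inP => w; rewrite inE.
Qed.

(* The pair is charged to the side with fewer endpoints. *)
Definition charged F phi psi : bool :=
  (hits phi psi == F) && (#|endpoints F| <= #|endpoints (hits psi phi)|)%N.

Lemma card_dexists (I : finType) (A : {set I}) (r : I -> {set V} -> bool) D :
  (forall i, i \in A -> #|[set T | r i T]| <= D)%N ->
  (#|[set T | [exists i in A, r i T]]| <= #|A| * D)%N.
Proof.
move=> rD; have -> : [set T | [exists i in A, r i T]] = \bigcup_(i in A) [set T | r i T].
  apply/setP => T; rewrite inE; apply/exists_inP/bigcupP => -[i iA];
    by rewrite ?inE => rT; exists i; rewrite ?inE.
rewrite -sum_nat_const.
apply: (big_rec2 (fun (B : {set {set V}}) n => (#|B| <= n)%N)) => [|i n B iA leB].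
  by rewrite cards0.
by apply: leq_trans (leq_card_setU _ _) _; rewrite leq_add ?rD.
Qed.

(* Here y is the edge cover number of F, so that the at most 2y vertices of psi
   known at any time span at most y * #|W| edges of H. *)
Lemma charged_le (Delta : nat) F :
  F \subset H -> F != set0 ->
  (forall S, #|[set T | nb S T]| <= Delta)%N ->
  theta * #|H|%:R <= 1 ->
  (1 + theta * (edge_cover_number F)%:R) ^+ (#|H| * Delta)
    <= 9 ^+ edge_cover_number F ->
  \sum_(phi in injs) \sum_(psi in injs) (charged F phi psi)%:R
    <= (4 * Delta%:R) ^+ edge_cover_number F * (theta / 2) ^+ #|endpoints F|
       * 9 ^+ edge_cover_number F * (#|injs|%:R * #|injs|%:R).
Proof.
move=> FH F0 nbD thm1 E9.
have /andP[f0 fv] := edge_cover_number_lt F0.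
have [L [fL sL gL LF]] := edge_cover_list F.
set k := edge_cover_number F in f0 fv E9 sL *; set v := #|endpoints F| in fv gL *.
have [gap0 theta0] : 0 < gap /\ 0 <= theta.
  by split; [exact: gap_gt0|apply: divr_ge0 => //; exact: ltW (gap_gt0 _ WV)].
pose y : R := k%:R.
have y1 : 1 <= y by rewrite ler1n.
have y0 : 0 < y by rewrite ltr0n.
have thy1 : theta * y <= 1.
  apply: le_trans thm1; rewrite ler_wpM2l// ler_nat.
  by apply: leq_trans (edge_cover_number_le F) _; apply: subset_leq_card.
pose H' := [set val e | e in H].
have H'2 : {in H', forall f : {set W}, #|f| = 2}.
  by move=> _ /imsetP[e _ ->]; rewrite card_pedge.
pose T : R := 9 ^+ k / y ^+ v.
have T0 : 0 <= T by rewrite divr_ge0 ?exprn_ge0 ?(ltW y0).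
have QT U al U' be : pairs_le (charged F) U al U' be (y ^+ #|U'| * T).
  apply: pairs_le_slice => phi _.
  pose Is := enum [set I | [exists e in F, nb (phi @: val e) I]].
  have sIs : (size Is <= #|H| * Delta)%N.
    rewrite -cardE; apply: leq_trans (card_dexists (fun e _ => nbD _)) _.
    by rewrite leq_mul2r subset_leq_card ?orbT.
  apply: (@le_trans _ _ (y ^+ #|U'| * ((1 + theta * y) ^+ size Is / y ^+ v)
      * #|cyl U' be|%:R)); last first.
    rewrite ler_wpM2r// ler_wpM2l ?exprn_ge0 ?(ltW y0)//.
    rewrite ler_wpM2r ?invr_ge0 ?exprn_ge0 ?(ltW y0)//.
    apply: le_trans E9; apply: ler_weXn2l => //.
    by rewrite lerDl mulr_ge0// ltW.
  apply: le_trans (scan_le WV y1 thy1 _ _ _ _); apply: ler_sum => psi _.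
  rewrite ler_nat; case: (boolP (charged _ _ _)) => //= /andP[/eqP hitsF vle].
  (* If psi(f) is near phi(e), then by symmetry e lies in [hits phi psi] = [F]. So psi(f) is one of
     the scanned sets, and the vertices of f are reached. *)
  suff -> : (v <= #|U' :|: reach Is psi|)%N by [].
  apply: leq_trans vle _; apply/subset_leq_card/subsetP => w.
  case/bigcupP => f; rewrite inE => /andP[fH /exists_inP[e eH near]] wf.
  rewrite inE; apply/orP; right; rewrite inE; apply/hasP.
  exists (psi @: val f); last by rewrite imset_f ?imsetS ?subsetT.
  rewrite mem_enum inE; apply/exists_inP; exists e; last by rewrite nbC.
  by rewrite -hitsF inE eH; apply/exists_inP; exists f => //; rewrite nbC.
have /card_gt0P[v0 _] : (0 < #|V|)%N by apply: leq_ltn_trans WV.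
pose al0 : {ffun W -> V} := [ffun=> v0].
have := tracked_le WV H'2 nbC nbD f0 T0 QT (L := L) (U := set0) al0 (U' := set0) al0 fL.
rewrite cards0 sL leqnn => /(_ isT).
rewrite /pairs_le !cyl0 gL expr0 mulr1.
(* The y^v gained by scanning cancels the y^v lost in tracking. *)
have -> : (4 * Delta%:R) ^+ k * (theta * k%:R / 2) ^+ v * T
   = (4 * Delta%:R) ^+ k * (theta / 2) ^+ v * 9 ^+ k.
  have yv0 : y ^+ v != 0 by rewrite expf_neq0 ?gt_eqF.
  rewrite /T -/y [theta * y / 2]mulrAC -mulrA -[RHS]mulrA.
  congr (_ * _).
  by rewrite [(_ * y) ^+ v]exprMn -mulrA [y ^+ v * _]mulrCA mulfV// mulr1.
apply: le_trans; apply: ler_sum => phi _; apply: ler_sum => psi _.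
rewrite ler_nat; case: (boolP (charged F phi psi)) => //= ch.
rewrite andbT; suff -> : touched H' nb phi psi L by [].
apply/allP => _ /LF[e eF ->]; case/andP: ch => /eqP hitsF _.
move: eF; rewrite -hitsF inE => /andP[_ /exists_inP[f fH near]].
by apply/exists_inP; exists (val f) => //; apply: imset_f.
Qed.

Lemma sum_cyl_mapsto (Y : {set V}) (s : seq W) (U : {set W}) (al : {ffun W -> V}) :
  uniq s -> {in s, forall w, w \notin U} ->
  \sum_(phi in cyl U al) (all (fun w => phi w \in Y) s)%:R
    <= (#|Y|%:R / gap) ^+ size s * #|cyl U al|%:R.
Proof.
elim: s U al => [|w s IH] U al /=.
  by move=> _ _; rewrite expr0 mul1r sumr_const.
move=> /andP[ws us] sU.
have -> : (#|Y|%:R / gap) ^+ (size s).+1 * #|cyl U al|%:R =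
  #|Y|%:R * (#|Y|%:R / gap) ^+ size s / gap * #|cyl U al|%:R.
  by rewrite exprS; ring.
apply: (sum_cyl_force WV (w := w)).
- by apply: sU; rewrite mem_head.
- by rewrite exprn_ge0// divr_ge0// ltW// gap_gt0.
- by move=> phi _ /negbTE ->.
move=> v _; apply: le_trans (IH (w |: U) (upd al w v) us _).
  by apply: ler_sum => phi _; rewrite ler_nat; case: (_ \in _).
move=> z zs; rewrite !inE negb_or sU ?inE ?zs ?orbT// andbT.
by apply: contraNneq ws => <-.
Qed.

(* The case d = 0, where the hypothesis of the theorem does not bound #|H| / n. *)
Lemma charged_le_independent F :
  (forall S T, nb S T -> S = T) ->
  \sum_(phi in injs) \sum_(psi in injs) (charged F phi psi)%:R
    <= theta ^+ #|endpoints F| * (#|injs|%:R * #|injs|%:R).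
Proof.
move=> nb_eq; rewrite exchange_big/= mulrA mulr_natr -sumr_const.
apply: ler_sum => psi _; rewrite -(cyl0 psi).
apply: (@le_trans _ _ ((#|psi @: [set: W]|%:R / gap) ^+ size (enum (endpoints F))
    * #|cyl set0 psi|%:R)); last first.
  rewrite ler_wpM2r// -cardE lerXn2r ?nnegrE ?divr_ge0 ?(ltW (gap_gt0 _ WV))//.
  by rewrite ler_wpM2r ?invr_ge0 ?(ltW (gap_gt0 _ WV))// ler_nat -[#|W|]cardsT leq_imset_card.
apply: le_trans (sum_cyl_mapsto _ _ _ _); rewrite ?enum_uniq//; last first.
  by move=> w _; rewrite inE.
apply: ler_sum => phi _; rewrite ler_nat.
case: (boolP (charged F phi psi)) => //= /andP[/eqP hitsF _].
suff -> : all (fun w => phi w \in psi @: [set: W]) (enum (endpoints F)) by [].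
apply/allP => w; rewrite mem_enum => /bigcupP[e]; rewrite -hitsF inE.
case/andP => _ /exists_inP[f _ /nb_eq phie] we.
have : phi w \in psi @: val f by rewrite -phie imset_f.
by apply/subsetP/imsetS/subsetT.
Qed.

End PairCount.

(** * Abundance of good injections *)

Section GoodInjections.
Local Open Scope set_scope.
Set Implicit Arguments.
Unset Strict Implicit.
Variables (R : realFieldType) (W V : finType).
Hypothesis WV : (#|W| < #|V|)%N.
Variables (H : sgraph W) (nb : rel {set V}) (d : nat).
Hypothesis nb2 : forall S T, nb S T -> #|T| = 2.
Hypothesis nbd : forall S, (#|[set T | nb S T] :\ S| <= d)%N.
Implicit Types (phi psi : {ffun W -> V}).

Let gap : R := (#|V| - #|W|)%N%:R.
Let theta : R := #|W|%:R / gap.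

Definition clash (phi : {ffun W -> V}) (e : pedge W) : bool :=
  [exists f in H, (phi @: val f != phi @: val e)
                  && nb (phi @: val e) (phi @: val f)].

Definition good : {set {ffun W -> V}} :=
  [set phi in @injs W V | [forall e in H, ~~ clash phi e]].

(* An edge of phi(H) near phi(e) has a vertex outside phi(e), which must be the
   image of one of the remaining vertices of W. *)
Lemma clash_le (e : pedge W) :
  \sum_(phi in @injs W V) (clash phi e)%:R <= d%:R * theta * #|@injs W V|%:R.
Proof.
have /eqP/cards2P[a [b [ab eE]]] := card_pedge e.
have /card_gt0P[v0 _] : (0 < #|V|)%N by apply: leq_ltn_trans WV.
rewrite -(cyl0 [ffun=> v0]).
apply: (sum_cyl_free (w := a)) => v1; apply: (sum_cyl_free (w := b)) => v2.
set be := upd _ b v2; set U := b |: (a |: set0).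
have eU : val e = U by rewrite eE /U setU0 setUC.
have phie phi : phi \in cyl U be -> phi @: val e = be @: val e.
  by move=> /cylP[_ agree]; apply: eq_in_imset => z; rewrite eU; apply: agree.
set S := be @: val e in phie *; pose Ts := [set T | nb S T] :\ S.
(* A clash is weakened: [T] need only lie in the image of [phi], so that a point of [T] outside
   phi(e) can be pulled back. *)
pose g T phi := (nb S T) && (T != S) && (T \subset phi @: [set: W]).
apply: (@le_trans _ _ (\sum_(T in Ts) \sum_(phi in cyl U be) (g T phi)%:R)).
  rewrite exchange_big; apply: ler_sum => phi phiC.
  case: (boolP (clash phi e)) => [/exists_inP[f fH /andP[neq nbST]]|_]; last first.
    exact: sumr_ge0.
  rewrite (bigD1 (phi @: val f))/=; last first.
    by rewrite !inE -(phie phi phiC) nbST andbT.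
  by rewrite /g -(phie phi phiC) nbST neq imsetS ?subsetT// lerDl sumr_ge0.
apply: (@le_trans _ _ (\sum_(T in Ts) (theta * #|cyl U be|%:R))); last first.
  rewrite sumr_const -[leLHS]mulr_natl -[leRHS]mulrA ler_wpM2r ?ler_nat ?nbd//.
  by rewrite mulr_ge0// divr_ge0// ltW ?gap_gt0.
apply: ler_sum => T; rewrite !inE => /andP[TS nbST].
have [x xT xS] : exists2 x, x \in T & x \notin S.
  apply/subsetPn; apply: contra TS => TS; rewrite eqEcard TS (nb2 nbST).
  by apply: leq_trans (leq_imset_card _ _) _; rewrite card_pedge.
have -> : theta = #|W|%:R * 1 / gap by rewrite mulr1.
apply: (sum_cyl_reveal WV (i := x)) => //.
- move=> phi phiC no; rewrite /g; case: (boolP (T \subset _)); rewrite ?andbF//.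
  move=> /subsetP/(_ x xT)/imsetP[w _ xw]; case: (boolP (w \in U)) => wU.
    by case/negP: xS; rewrite -(phie _ phiC) eU xw imset_f.
  by case: (no w wU).
move=> w wU; rewrite mul1r -sumr_const; apply: ler_sum => phi _.
by rewrite lern1 leq_b1.
Qed.

(** Union bound over the edges of [H], each clashing with probability at most d * theta. *)
Lemma card_good_ge :
  (1 - d%:R * #|H|%:R * theta) * #|@injs W V|%:R <= #|good|%:R :> R.
Proof.
have -> : #|good|%:R = \sum_(phi in @injs W V) ([forall e in H, ~~ clash phi e])%:R :> R.
  rewrite -sumr_const big_mkcond [RHS]big_mkcond /=; apply: eq_bigr => phi _.
  by rewrite [phi \in good]inE; case: (phi \in _) => //=; rewrite -mulrb.
rewrite mulrBl mul1r lerBlDr.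
apply: (@le_trans _ _ (\sum_(phi in @injs W V) ([forall e in H, ~~ clash phi e]%:R
    + \sum_(e in H) (clash phi e)%:R))).
  rewrite -sumr_const; apply: ler_sum => phi _.
  have [_|] := boolP [forall e in H, ~~ clash phi e].
    by rewrite lerDl sumr_ge0.
  rewrite negb_forall_in => /exists_inP[e eH]; rewrite negbK add0r => ce.
  by rewrite (bigD1 e)//= ce lerDl sumr_ge0.
rewrite big_split /= lerD2l exchange_big/=.
apply: le_trans (ler_sum _ (fun e _ => clash_le e)) _.
by rewrite sumr_const -[leLHS]mulr_natl !mulrA [_ * d%:R]mulrC.
Qed.

End GoodInjections.

Lemma sum_symmetrized (R : pzSemiRingType) (I : finType) (A : {pred I})
    (g : I -> I -> R) (c : R) :
  \sum_(i in A) \sum_(j in A) c * (g i j + g j i) =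
  c * (\sum_(i in A) \sum_(j in A) g i j)
  + c * (\sum_(i in A) \sum_(j in A) g i j).
Proof.
rewrite [in X in _ = _ + X]exchange_big !mulr_sumr -big_split.
apply: eq_bigr => i _; rewrite !mulr_sumr -big_split.
by apply: eq_bigr => j _; rewrite mulrDr.
Qed.

(** * Chebyshev's inequality for the number of good copies *)

Section Chebyshev.
Local Open Scope set_scope.
Set Implicit Arguments.
Unset Strict Implicit.
Variables (R : realFieldType) (W V : finType).
Variables (H : sgraph W) (D : sgraph (pedge V)) (q : sgraph V -> R) (p : R).
Hypothesis p0 : 0 < p.
Hypothesis q_ge0 : forall G, 0 <= q G.
Hypothesis q_sum : \sum_G q G = 1.
Hypothesis q_indep : forall S : sgraph V,
  {in S &, forall i j, ~~ adj D i j} ->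
  \sum_(G : sgraph V | S \subset G) q G = p ^+ #|S|.
Implicit Types (phi psi : {ffun W -> V}) (F : sgraph W).

Lemma adjC (T : finType) (G : sgraph T) : symmetric (adj G).
Proof. by move=> x y; apply: eq_existsb => e; rewrite setUC. Qed.

Lemma adj_irr (T : finType) (G : sgraph T) x : adj G x x = false.
Proof.
apply/negbTE/negP => /exists_inP[e _ /eqP ex].
by have := card_pedge e; rewrite ex setUid cards1.
Qed.

(* The closed neighbourhood relation of D, on pairs of vertices seen as sets. *)
Definition dnear (S T : {set V}) : bool :=
  [exists i : pedge V, exists j : pedge V,
     [&& val i == S, val j == T & (i == j) || adj D i j]].

Lemma dnearP S T : reflect (exists i j : pedge V,
  [/\ val i = S, val j = T & (i == j) || adj D i j]) (dnear S T).
Proof.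
apply: (iffP existsP) => [[i /existsP[j /and3P[/eqP iS /eqP jT ij]]]|[i [j [iS jT ij]]]].
  by exists i, j.
by exists i; apply/existsP; exists j; rewrite iS jT !eqxx.
Qed.

Lemma dnearC : symmetric dnear.
Proof.
have sub S T : dnear S T -> dnear T S.
  case/dnearP => i [j [iS jT ij]]; apply/dnearP; exists j, i; split=> //.
  by rewrite eq_sym adjC.
by move=> S T; apply/idP/idP; apply: sub.
Qed.

Lemma dnear2 S T : dnear S T -> #|T| = 2.
Proof. by case/dnearP => i [j [_ <- _]]; apply: card_pedge. Qed.

Lemma dnear_degree d S : (forall i, degree D i <= d)%N ->
  (#|[set T | dnear S T] :\ S| <= d)%N.
Proof.
move=> degD; have [[i /eqP iS]|no] := altP (@existsP _ (fun i : pedge V => val i == S)).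
  apply: leq_trans (degD i); rewrite /degree -[X in (_ <= X)%N](card_imset _ val_inj).
  apply/subset_leq_card/subsetP => T; rewrite !inE => /andP[TS /dnearP[i' [j [i'S jT]]]].
  have {i'S} -> : i' = i by apply: val_inj; rewrite i'S.
  case/orP => [/eqP ij|ij]; first by rewrite -jT -ij iS eqxx in TS.
  by apply/imsetP; exists j; rewrite ?inE.
rewrite (_ : _ :\ _ = set0) ?cards0//; apply/setP => T; rewrite !inE.
apply/negbTE/negP => /andP[_ /dnearP[i [j [iS _ _]]]].
by case/negP: no; apply/existsP; exists i; apply/eqP.
Qed.

(** Stated through [val], since a non-injective [phi] may collapse an edge to a single vertex. *)
Definition embed phi F : sgraph V :=
  [set i : pedge V | [exists e in F, val i == phi @: val e]].

Lemma embedP phi F i :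
  reflect (exists2 e, e \in F & val i = phi @: val e) (i \in embed phi F).
Proof.
rewrite inE; apply: (iffP exists_inP) => -[e eF /eqP ie]; exists e => //.
Qed.

Lemma card_embed phi F : injective phi -> #|embed phi F| = #|F|.
Proof.
move=> injphi; rewrite -(card_imset (mem (embed phi F)) val_inj).
have injset : injective (fun e : pedge W => phi @: val e).
  by move=> e f /(imset_inj injphi)/val_inj.
rewrite -(card_imset (mem F) injset); congr #|pred_of_set _|.
apply/setP => S; apply/imsetP/imsetP => [[i /embedP[e eF ie] ->]|[e eF ->]].
  by exists e.
have e2 : #|phi @: val e| == 2 by rewrite card_imset// card_pedge.
exists (Sub (phi @: val e) e2 : pedge V); rewrite ?SubK//.
by apply/embedP; exists e; rewrite ?SubK.
Qed.

Lemma good_independent phi : phi \in good H dnear ->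
  {in embed phi H &, forall i j, ~~ adj D i j}.
Proof.
rewrite !inE => /andP[_ /forall_inP noclash] i j /embedP[e eH ie] /embedP[f fH jf].
apply: contra (noclash e eH) => ij; apply/exists_inP; exists f => //.
rewrite -ie -jf; apply/andP; split.
  by apply: contraTneq ij => /val_inj ->; rewrite adj_irr.
by apply/dnearP; exists i, j; rewrite ij orbT.
Qed.

Lemma embed_sub phi F F' : F \subset F' -> embed phi F \subset embed phi F'.
Proof.
move=> FF'; apply/subsetP => i /embedP[e eF ie]; apply/embedP; exists e => //.
exact: (subsetP FF').
Qed.

Definition joint phi psi : R :=
  \sum_(G : sgraph V | (embed phi H \subset G) && (embed psi H \subset G)) q G.

Lemma jointC phi psi : joint phi psi = joint psi phi.
Proof. by apply: eq_bigl => G; rewrite andbC. Qed.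

(** Once the hits are deleted, no edge left in phi(H) equals or is D-adjacent to an edge of psi(H),
    and goodness excludes adjacencies inside either copy, so [q_indep] applies to the union. *)
Lemma sum_separated phi psi : phi \in good H dnear -> psi \in good H dnear ->
  \sum_(G : sgraph V | embed phi (H :\: hits H dnear phi psi) :|: embed psi H \subset G) q G
   = p ^+ (#|H| - #|hits H dnear phi psi| + #|H|).
Proof.
move=> gphi gpsi; set F := hits _ _ _ _.
have [injphi injpsi] : injective phi /\ injective psi.
  by move: gphi gpsi; rewrite !inE => /andP[/injectiveP ? _] /andP[/injectiveP ? _].
have far i j : i \in embed phi (H :\: F) -> j \in embed psi H ->
    ~~ ((i == j) || adj D i j).
  move=> /embedP[e]; rewrite inE => /andP[eF eH] ie /embedP[f fH jf].
  apply: contra eF => ij; rewrite inE eH; apply/exists_inP; exists f => //.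
  by apply/dnearP; exists i, j.
rewrite q_indep; last first.
  move=> i j /setUP[iphi|ipsi] /setUP[jphi|jpsi].
  - by apply: (good_independent gphi);
      apply: (subsetP (embed_sub phi (subsetDl H F))).
  - by have := far i j iphi jpsi; rewrite negb_or => /andP[].
  - by have := far j i jphi ipsi; rewrite negb_or adjC => /andP[].
  - exact: (good_independent gpsi).
rewrite cardsU (_ : _ :&: _ = set0) ?cards0 ?subn0 ?card_embed//.
  by rewrite cardsD (setIidPr _)//; apply/subsetP => e; rewrite inE => /andP[].
apply/setP => i; rewrite in_set0; apply/negbTE/negP => /setIP[iphi ipsi].
by have := far i i iphi ipsi; rewrite eqxx.
Qed.

(** No longer requiring the hit edges of phi(H) only enlarges the event. *)
Lemma joint_le phi psi : phi \in good H dnear -> psi \in good H dnear ->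
  joint phi psi <= p ^+ #|H| * p ^+ #|H| * p ^- #|hits H dnear phi psi|.
Proof.
move=> gphi gpsi; set F := hits _ _ _ _.
have FH : (#|F| <= #|H|)%N.
  by apply/subset_leq_card/subsetP => e; rewrite inE => /andP[].
have -> : p ^+ #|H| * p ^+ #|H| * p ^- #|F| = p ^+ (#|H| - #|F| + #|H|).
  rewrite exprD -{1}(subnK FH) exprD -!mulrA [p ^+ #|F| * _]mulrCA.
  by rewrite mulfV ?mulr1// expf_neq0// gt_eqF.
rewrite -sum_separated// -/F /joint big_mkcond [leRHS]big_mkcond; apply: ler_sum => G _.
case: ifP => [/andP[phiG psiG]|_]; last by case: ifP.
rewrite ifT// subUset psiG andbT; apply: subset_trans phiG.
exact/embed_sub/subsetDl.
Qed.

Lemma joint_separated phi psi : phi \in good H dnear -> psi \in good H dnear ->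
  hits H dnear phi psi = set0 -> joint phi psi = p ^+ #|H| * p ^+ #|H|.
Proof.
move=> gphi gpsi F0; have := sum_separated gphi gpsi.
rewrite F0 setD0 cards0 subn0 exprD => <-.
by apply: eq_bigl => G; rewrite subUset.
Qed.

Lemma sum_embed phi : phi \in good H dnear ->
  \sum_(G : sgraph V | embed phi H \subset G) q G = p ^+ #|H|.
Proof.
move=> gphi; rewrite q_indep ?card_embed//; last exact: good_independent.
by move: gphi; rewrite !inE => /andP[/injectiveP].
Qed.

(** The covariance vanishes without hits. Otherwise it is at most the joint probability, and
    [joint_le] is used from the side whose hits have fewer endpoints, where a charged indicator
    equals 1. *)
Lemma joint_charged phi psi : phi \in good H dnear -> psi \in good H dnear ->
  joint phi psi - p ^+ #|H| * p ^+ #|H| <=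
  p ^+ #|H| * p ^+ #|H| * (\sum_(F : sgraph W | nonempty_sub H F)
     p ^- #|F| * ((charged H dnear F phi psi)%:R + (charged H dnear F psi phi)%:R)).
Proof.
move=> gphi gpsi; set pH := _ * _.
have pH0 : 0 < pH by rewrite mulr_gt0 ?exprn_gt0.
have term0 F : 0 <= p ^- #|F| *
    ((charged H dnear F phi psi)%:R + (charged H dnear F psi phi)%:R).
  by apply: mulr_ge0; rewrite ?addr_ge0// invr_ge0 exprn_ge0 ?ltW.
have [F0|F0] := eqVneq (hits H dnear phi psi) set0.
  by rewrite joint_separated// subrr mulr_ge0 ?sumr_ge0// ltW.
apply: (@le_trans _ _ (joint phi psi)); first by rewrite gerBl ltW.
have hitsH phi' psi' : hits H dnear phi' psi' \subset H.
  by apply/subsetP => e; rewrite inE => /andP[].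
case: (leqP #|endpoints (hits H dnear phi psi)|
            #|endpoints (hits H dnear psi phi)|) => le_v.
  apply: le_trans (joint_le gphi gpsi) _; rewrite ler_pM2l//.
  rewrite (bigD1 (hits H dnear phi psi))/=; last by rewrite /nonempty_sub F0 hitsH.
  rewrite {1}/charged eqxx le_v ler_wpDr ?sumr_ge0//.
  by rewrite ler_peMr ?invr_ge0 ?exprn_ge0 ?(ltW p0)//= mulr1n lerDl.
rewrite jointC; apply: le_trans (joint_le gpsi gphi) _; rewrite ler_pM2l//.
rewrite (bigD1 (hits H dnear psi phi))/=; last first.
  (* By symmetry of [dnear], the edge f that witnesses a hit is itself hit in the other
     direction. *)
  rewrite /nonempty_sub hitsH andbT; have /set0Pn[e] := F0.
  rewrite inE => /andP[eH /exists_inP[f fH near_ef]]; apply/set0Pn; exists f.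
  by rewrite inE fH; apply/exists_inP; exists e => //; rewrite dnearC.
rewrite {2}/charged eqxx (ltnW le_v) ler_wpDr ?sumr_ge0//.
by rewrite ler_peMr ?invr_ge0 ?exprn_ge0 ?(ltW p0)//= mulr1n lerDr.
Qed.

Definition no_copy (G : sgraph V) : bool :=
  [forall phi in @injs W V, ~~ (embed phi H \subset G)].

(** The number [X] of good copies present has mean N p^#|H| and is 0 if there is no copy. The factor
    p^(2 #|H|) cancels, and the 2 comes from the two directions in which a pair may be charged. *)
Lemma second_moment :
  (\sum_(G | no_copy G) q G) * #|good H dnear|%:R ^+ 2 <=
  2 * \sum_(F : sgraph W | nonempty_sub H F) p ^- #|F| *
     \sum_(phi in @injs W V) \sum_(psi in @injs W V) (charged H dnear F phi psi)%:R.
Proof.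
set N : R := #|_|%:R; set pH := p ^+ #|H|.
have pH0 : 0 < pH by rewrite exprn_gt0.
pose X (G : sgraph V) : R := \sum_(phi in good H dnear) (embed phi H \subset G)%:R.
have good_injs : good H dnear \subset @injs W V.
  by apply/subsetP => phi; rewrite inE => /andP[].
have EX : \sum_G q G * X G = N * pH.
  under eq_bigr do rewrite mulr_sumr.
  rewrite exchange_big/= mulr_natl -sumr_const; apply: eq_bigr => phi gphi.
  rewrite /pH -(sum_embed gphi) [RHS]big_mkcond; apply: eq_bigr => G _.
  by case: (_ \subset _); rewrite ?mulr1 ?mulr0.
have EX2 : \sum_G q G * X G ^+ 2 =
    \sum_(phi in good H dnear) \sum_(psi in good H dnear) joint phi psi.
  under eq_bigr do rewrite expr2 big_distrlr/= mulr_sumr.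
  rewrite exchange_big/=; apply: eq_bigr => phi _.
  under eq_bigr do rewrite mulr_sumr.
  rewrite exchange_big/=; apply: eq_bigr => psi _.
  rewrite /joint [RHS]big_mkcond; apply: eq_bigr => G _.
  by case: (_ \subset _); case: (_ \subset _); rewrite /= ?mulr1 ?mulr0 ?mul0r.
have variance : \sum_G q G * (X G - N * pH) ^+ 2 =
    \sum_(phi in good H dnear) \sum_(psi in good H dnear) (joint phi psi - pH * pH).
  have -> : \sum_G q G * (X G - N * pH) ^+ 2 = \sum_G q G * X G ^+ 2
      - 2 * (N * pH) * (\sum_G q G * X G) + (N * pH) ^+ 2 * \sum_G q G.
    rewrite !mulr_sumr -sumrB -big_split/=; apply: eq_bigr => G _; ring.
  under [RHS]eq_bigr do rewrite sumrB.
  rewrite sumrB EX EX2 q_sum [X in _ = _ - X](eq_bigr (fun=> N * (pH * pH))); last first.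
    by move=> phi _; rewrite sumr_const -[LHS]mulr_natl.
  rewrite sumr_const -[X in _ = _ - X]mulr_natl -/N; ring.
have chebyshev : (\sum_(G | no_copy G) q G) * N ^+ 2 * (pH * pH) <=
    \sum_G q G * (X G - N * pH) ^+ 2.
  have -> : (\sum_(G | no_copy G) q G) * N ^+ 2 * (pH * pH) =
     \sum_(G | no_copy G) q G * (N * pH) ^+ 2.
    rewrite -mulr_suml; ring.
  rewrite big_mkcond; apply: ler_sum => G _; case: ifP => [noG|_].
    rewrite (_ : X G = 0) ?sub0r ?sqrrN//; apply: big1 => phi gphi.
    by rewrite (negbTE (forall_inP noG phi _))// (subsetP good_injs).
  by rewrite mulr_ge0 ?sqr_ge0.
rewrite -(ler_pM2r (mulr_gt0 pH0 pH0)); apply: le_trans chebyshev _.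
rewrite variance; set S := (X in _ <= 2 * X * _).
have -> : 2 * S * (pH * pH) = pH * pH * (S + S) by ring.
(* The bounds are nonnegative, so the sums may be extended from good to all injections, where the
   counting estimates apply. *)
apply: (@le_trans _ _ (\sum_(phi in @injs W V) \sum_(psi in @injs W V)
   pH * pH * (\sum_(F : sgraph W | nonempty_sub H F)
     p ^- #|F| * ((charged H dnear F phi psi)%:R + (charged H dnear F psi phi)%:R)))).
  have t0 phi psi : 0 <= pH * pH * (\sum_(F : sgraph W | nonempty_sub H F)
     p ^- #|F| * ((charged H dnear F phi psi)%:R + (charged H dnear F psi phi)%:R)).
    rewrite mulr_ge0 ?sumr_ge0 ?mulr_ge0 ?(ltW pH0)// => F _.
    by apply: mulr_ge0; rewrite ?addr_ge0// invr_ge0 exprn_ge0 ?ltW.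
  rewrite [leLHS]big_mkcond [leRHS]big_mkcond; apply: ler_sum => phi _.
  case: ifP => [gphi|_]; last by case: ifP => // _; apply: sumr_ge0.
  rewrite (subsetP good_injs _ gphi) [leLHS]big_mkcond [leRHS]big_mkcond.
  apply: ler_sum => psi _; case: ifP => [gpsi|_]; last by case: ifP.
  by rewrite (subsetP good_injs _ gpsi) joint_charged.
under eq_bigr do rewrite -mulr_sumr.
rewrite -mulr_sumr ler_pM2l ?mulr_gt0//.
rewrite -big_split/=.
under eq_bigr do rewrite exchange_big/=.
rewrite exchange_big/=; apply: ler_sum => F _.
by rewrite (sum_symmetrized _ (fun phi psi => (charged H dnear F phi psi)%:R)).
Qed.

End Chebyshev.

(** * Embeddings and copies *)

Section Copies.
Local Open Scope set_scope.
Set Implicit Arguments.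
Unset Strict Implicit.
Variables (W V : finType).
Implicit Types (H F : sgraph W) (G : sgraph V).

Lemma adj_embed (phi : {ffun W -> V}) H x y : injective phi ->
  adj (embed phi H) (phi x) (phi y) = adj H x y.
Proof.
move=> injphi; have im2 : phi @: [set x; y] = [set phi x; phi y].
  by rewrite imsetU1 imset_set1.
apply/exists_inP/exists_inP => [[i /embedP[e eH ie] /eqP ixy]|[e eH /eqP exy]].
  by exists e => //; apply/eqP/(imset_inj injphi); rewrite -ie ixy.
have e2 : #|phi @: val e| == 2 by rewrite card_imset// card_pedge.
exists (Sub (phi @: val e) e2 : pedge V); first by apply/embedP; exists e; rewrite ?SubK.
by rewrite SubK exy im2.
Qed.

Lemma no_copyN H G : ~ contains_copy H G -> no_copy H G.
Proof.
move=> nocopy; apply/forall_inP => phi; rewrite inE => /injectiveP injphi.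
apply/negP => imG; apply: nocopy; exists (phi @: [set: W]), (embed phi H); split.
  split=> //; apply/subsetP => x /bigcupP[i /embedP[e _ ->]].
  by apply/subsetP/imsetS/subsetT.
by exists phi; split=> // x y; apply: adj_embed.
Qed.

Lemma injs_gt0 : (#|W| <= #|V|)%N -> (0 < #|@injs W V|)%N.
Proof. by move=> WV; rewrite card_inj_ffuns ffact_gt0. Qed.

Lemma endpoints1 (e : pedge W) : #|endpoints [set e]| = 2.
Proof. by rewrite /endpoints big_set1 card_pedge. Qed.

End Copies.

From mathcomp Require Import all_classical all_reals all_analysis.
Import numFieldNormedType.Exports.
Local Open Scope classical_set_scope.
Local Open Scope ring_scope.

(** * Point masses and independence in the random graph *)

Section FiniteProbability.
Set Implicit Arguments.
Unset Strict Implicit.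
Variables (R : realType) (V : finType) (P : probability (sgraph V) R).

Definition mass (G : sgraph V) : R := fine (P [set G]).

Lemma mass_ge0 G : 0 <= mass G.
Proof. by rewrite fine_ge0. Qed.

Lemma massE G : P [set G] = (mass G)%:E.
Proof. by rewrite fineK// fin_num_measure. Qed.

Lemma prob_sum (a : pred (sgraph V)) :
  P [set G | a G] = (\sum_(G | a G) mass G)%:E.
Proof.
have -> : [set G | a G] = [set G | G \in enum a].
  by apply/seteqP; split=> G /=; rewrite mem_enum.
rewrite -big_enum/=; elim: (enum a) (enum_uniq a) => [|G s IH] /=.
  by rewrite big_nil (_ : [set _ | _] = set0) ?measure0// -subset0 => G.
move=> /andP[Gs us]; rewrite big_cons EFinD -massE -IH//.
rewrite -measureU//.
  congr (P _); apply/seteqP; split=> G' /=; rewrite inE.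
    by case/orP => [/eqP|]; [left|right].
  by case=> [->|->]; rewrite ?eqxx ?orbT.
by rewrite -subset0 => G' [/= -> G's]; rewrite G's in Gs.
Qed.

Lemma mass_sum : \sum_G mass G = 1.
Proof.
apply: EFin_inj; rewrite -(prob_sum predT) (_ : [set _ | _] = setT).
  exact: probability_setT.
by apply/seteqP; split.
Qed.

Lemma present_cons (j : pedge V) s :
  [set G : sgraph V | all (fun i => i \in G) (j :: s)] =
  [set G : sgraph V | j \in G] `&` [set G : sgraph V | all (fun i => i \in G) s].
Proof. by apply/seteqP; split=> G /= => [/andP[]|[-> ->]]. Qed.

Lemma edge_event (j : pedge V) :
  g_sigma_algebra_preimage (edge_rv P j) [set G : sgraph V | j \in G].
Proof.
exists [set true] => //; rewrite setTI; apply/seteqP.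
by split=> G /=; rewrite /edge_indicator.
Qed.

Lemma sigma_family_present (I : set (pedge V)) (s : seq (pedge V)) :
  {in s, forall j, I j} ->
  sigma_family (edge_rv P) I [set G : sgraph V | all (fun i => i \in G) s].
Proof.
rewrite /sigma_family; set gen := \bigcup_(j in I) _.
(* Membership in the generated sigma-algebra is recast as measurability, which gives closure under
   intersection. *)
change ({in s, forall j, I j} -> @measurable _ (g_sigma_algebraType gen)
  [set G : sgraph V | all (fun i => i \in G) s]).
elim: s => [|j s IH] sI.
  by rewrite (_ : [set _ | _] = setT)//; apply/seteqP; split.
rewrite present_cons; apply: measurableI; last first.
  by apply: IH => i si; apply: sI; rewrite inE si orbT.
apply: sub_sigma_algebra; exists j; first by apply: sI; rewrite mem_head.
exact: edge_event.
Qed.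

(** Edges of [S] are split off one at a time: each is D-adjacent to none of the rest, so its
    presence is independent of the event that the rest are all present. *)
Lemma mass_indep (p : R) (D : sgraph (pedge V)) :
  (forall e, P [set G : sgraph V | e \in G] = p%:E) ->
  dependency_graph (edge_rv P) D ->
  forall S : sgraph V, {in S &, forall i j, ~~ adj D i j} ->
  \sum_(G : sgraph V | S \subset G) mass G = p ^+ #|S|.
Proof.
move=> Pp DD S indS; apply: EFin_inj; rewrite -(prob_sum (fun G => S \subset G)).
have -> : [set G : sgraph V | S \subset G] =
    [set G : sgraph V | all (fun i => i \in G) (enum S)].
  apply/seteqP; split=> G /= SG.
    by apply/allP => i; rewrite mem_enum; apply/fintype.subsetP.
  apply/fintype.subsetP => i iS; move/allP: SG; apply.
  by rewrite mem_enum.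
have {indS} : {in enum S &, forall i j, ~~ adj D i j}.
  by move=> i j; rewrite !mem_enum; apply: indS.
rewrite cardE; elim: (enum S) (enum_uniq S) => [|i s IH] /=.
  move=> _ _; rewrite expr0 (_ : [set _ | _] = setT) ?probability_setT//.
  by apply/seteqP; split.
move=> /andP[is_ us] ind; rewrite present_cons exprS EFinM -(Pp i) -IH//; last first.
  by move=> a b sa sb; apply: ind; rewrite inE ?sa ?sb orbT.
apply: DD; first exact: edge_event.
apply: sigma_family_present => j js /=; split.
  by apply: contraNneq is_ => <-.
by apply: ind; rewrite inE ?eqxx// js orbT.
Qed.

End FiniteProbability.

(** * Numerical estimates *)

Section Estimates.
Set Implicit Arguments.
Unset Strict Implicit.
Variable R : realType.

(** By 1 + t <= exp(t) the power is at most exp(1.83)^f. With z at most 1.83 / 8, exp(z) <= 1 / (1 -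
    z) <= 1.3, and three squarings stay below 9. *)
Lemma pow_1D_le9 (x : R) (M f : nat) : 0 <= x -> M%:R * x <= 183 / 100 ->
  (1 + x * f%:R) ^+ M <= 9 ^+ f.
Proof.
move=> x0 Mx; pose z := M%:R * x / 8.
have z_small : z <= 183 / 800 by rewrite /z; lra.
have expz : expR z <= 13 / 10.
  have : 1 - z <= (expR z)^-1 by rewrite -expRN; exact: expR_ge1Dx.
  rewrite -ler_pV2 ?inE ?unitfE ?invr_gt0 ?expR_gt0 ?invr_eq0 ?gt_eqF;
    rewrite ?expR_gt0 ?subr_gt0//; try lra.
  rewrite invrK => /le_trans; apply.
  rewrite invf_ple ?posrE; lra.
apply: (@le_trans _ _ (expR (x * f%:R) ^+ M)).
  by apply: lerXn2r; rewrite ?nnegrE ?addr_ge0 ?mulr_ge0 ?expR_ge0// expR_ge1Dx.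
rewrite -expRM_natl (_ : M%:R * (x * f%:R) = f%:R * (8%:R * z)); last first.
  by rewrite /z; field.
rewrite !expRM_natl; apply: lerXn2r; rewrite ?nnegrE ?exprn_ge0 ?expR_ge0//.
have sq a b : 0 <= a -> a <= b -> a ^+ 2 <= b ^+ 2 :> R.
  by move=> a0 ab; rewrite lerXn2r// nnegrE// (le_trans a0).
have e2 : expR z ^+ 2 <= 169 / 100.
  by apply: le_trans (sq _ _ (expR_ge0 z) expz) _; lra.
have e4 : expR z ^+ 4 <= 286 / 100.
  have -> : expR z ^+ 4 = (expR z ^+ 2) ^+ 2 by rewrite -exprM.
  by apply: le_trans (sq _ _ _ e2) _; rewrite ?exprn_ge0 ?expR_ge0//; lra.
have -> : expR z ^+ 8 = (expR z ^+ 4) ^+ 2 by rewrite -exprM.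
by apply: le_trans (sq _ _ _ e4) _; rewrite ?exprn_ge0 ?expR_ge0//; lra.
Qed.

Variables (W : finType) (H F : sgraph W) (n d : nat).
Hypothesis Wn : (63 * #|W| <= n)%N.
Hypothesis n0 : (0 < n)%N.
Hypothesis dHW : d%:R * #|H|%:R * #|W|%:R / n%:R < 9 / 10 :> R.

Let theta : R := #|W|%:R / (n - #|W|)%N%:R.

Lemma card_lt_ord : (#|W| < #|'I_n|)%N.
Proof. by rewrite card_ord; clear -Wn n0; lia. Qed.

(** The assumption 63 #|W| <= n gives n - #|W| >= 62 n / 63. *)
Lemma theta_le : theta <= 63 / 62 * (#|W|%:R / n%:R).
Proof.
have n0R : 0 < n%:R :> R by rewrite ltr0n.
have WnR : 63 * #|W|%:R <= n%:R :> R by rewrite -natrM ler_nat.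
have W0 : 0 <= #|W|%:R :> R by [].
have leWn : (#|W| <= n)%N by clear -Wn; lia.
rewrite /theta natrB// ler_pdivrMr; last by lra.
rewrite mulrA mulrAC ler_pdivlMr//; nra.
Qed.

(** Since 0.9 * 63 / 62 < 0.915. *)
Lemma dHtheta_le : d%:R * #|H|%:R * theta <= 915 / 1000.
Proof.
apply: le_trans (ler_wpM2l _ theta_le) _; first by rewrite mulr_ge0.
have -> : d%:R * #|H|%:R * (63 / 62 * (#|W|%:R / n%:R))
   = 63 / 62 * (d%:R * #|H|%:R * #|W|%:R / n%:R) :> R by ring.
by move: dHW; set x := _ * _ / _; lra.
Qed.

Variable D : sgraph (pedge 'I_n).
Hypothesis degD : forall i, (degree D i <= d)%N.
Hypothesis HF : nonempty_sub H F.

(** The slack 1 / 36, which later yields the constant 10, comes from f(F) <= |V(F)| - 1 when d >= 1,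
    and from |V(F)| >= 2 when d = 0. *)
Lemma charged_coeff :
  \sum_(phi in @injs W 'I_n) \sum_(psi in @injs W 'I_n) (charged H (dnear D) F phi psi)%:R
  <= 36^-1 * ((20 * #|W|%:R / n%:R) ^+ #|endpoints F| * d.+1%:R ^+ edge_cover_number F)
     * (#|@injs W 'I_n|%:R * #|@injs W 'I_n|%:R) :> R.
Proof.
have /andP[F0 FH] := HF.
have /andP[f0 fv] := edge_cover_number_lt F0.
have v0 : (0 < #|endpoints F|)%N by apply: leq_ltn_trans fv.
have fv1 : (edge_cover_number F <= #|endpoints F|.-1)%N by rewrite -ltnS prednK.
have theta0 : 0 <= theta by rewrite divr_ge0.
have gapE : #|'I_n| = n by rewrite card_ord.
set r : R := #|W|%:R / n%:R.
have r0 : 0 <= r by rewrite divr_ge0.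
have -> : 20 * #|W|%:R / n%:R = 20 * r by rewrite mulrA.
set v := #|endpoints F| in fv v0 fv1 *.
set f := edge_cover_number F in f0 fv fv1 *.
case: d dHW degD dHtheta_le => [|d'] dHW' degD' dHt.
  apply: le_trans (@charged_le_independent R W _ card_lt_ord H (dnear D) F _) _.
    move=> S T /dnearP[i [j [<- <- /orP[/eqP->//|ij]]]].
    have := degD' i; rewrite /degree leqn0 cards_eq0 => /eqP/setP/(_ j).
    by rewrite !inE ij.
  rewrite ler_wpM2r ?mulr_ge0// expr1n mulr1 gapE -/theta.
  have le1 : theta <= 20 / 19 * r by apply: le_trans theta_le _; rewrite -/r; nra.
  apply: (@le_trans _ _ ((20 / 19 * r) ^+ v)).
    by apply: lerXn2r; rewrite ?nnegrE// mulr_ge0.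
  rewrite mulrAC exprMn exprVn mulrC ler_wpM2r ?exprn_ge0 ?mulr_ge0//.
  rewrite lef_pV2 ?posrE ?exprn_gt0// .
  (* 19^v >= 19^2 > 36, as [F] has at least two endpoints. *)
  apply: (@le_trans _ _ (19 ^+ 2)); first by lra.
  by rewrite ler_weXn2l ?ler1n//; apply: leq_ltn_trans f0 fv.
pose Delta := d'.+2.
(* As d >= 1, d + 1 <= 2d; twice 0.915 is the 1.83 of [pow_1D_le9]. *)
have mDt : (#|H| * Delta)%:R * theta <= 183 / 100 :> R.
  apply: (@le_trans _ _ (2 * (d'.+1%:R * #|H|%:R * theta))); last by lra.
  rewrite mulrA ler_wpM2r// -!natrM ler_nat mulnC mulnA leq_mul2r.
  by rewrite mul2n -addnn /Delta -[d'.+2]addn1 leq_add2l orbT.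
apply: le_trans (@charged_le R W _ card_lt_ord H (dnear D) (dnearC D) Delta F FH F0 _ _ _) _.
- move=> S; rewrite (cardsD1 S) /Delta -add1n leq_add ?leq_b1//.
  exact: dnear_degree.
- rewrite gapE -/theta; apply: le_trans (_ : d'.+1%:R * #|H|%:R * theta <= 1); last by lra.
  by rewrite mulrC ler_wpM2r// -natrM ler_nat leq_pmull.
- by rewrite gapE -/theta; apply: pow_1D_le9.
rewrite ler_wpM2r ?mulr_ge0// gapE -/theta -/f -/v exprMn.
have -> : 4 ^+ f * Delta%:R ^+ f * (theta / 2) ^+ v * 9 ^+ f
   = 36 ^+ f * (theta / 2) ^+ v * Delta%:R ^+ f :> R.
  have -> : 36 = 4 * 9 :> R by lra.
  rewrite [(4 * 9) ^+ f]exprMn -!mulrA; congr (_ * _).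
  by rewrite mulrCA [RHS]mulrCA [X in _ * X = _]mulrC.
rewrite mulrA ler_wpM2r ?exprn_ge0//.
(* Using f <= v - 1 saves a factor 36; the base left is 36 * theta / 2 = 18 * theta <= 20 #|W| /
   n. *)
apply: (@le_trans _ _ (36 ^+ v.-1 * (theta / 2) ^+ v)).
  by rewrite ler_wpM2r ?exprn_ge0 ?divr_ge0// ler_weXn2l ?ler1n.
have -> : 36 ^+ v.-1 = 36^-1 * 36 ^+ v :> R.
  by rewrite -[in RHS](prednK v0) exprS mulKf// pnatr_eq0.
rewrite -mulrA ler_wpM2l// -exprMn.
apply: lerXn2r; rewrite ?nnegrE ?mulr_ge0 ?divr_ge0//.
have := theta_le; rewrite -/r; lra.
Qed.

End Estimates.

(** * The bound on the probability of no copy *)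

Section CopyProbability.
Set Implicit Arguments.
Unset Strict Implicit.
Variable R : realType.

Lemma Phi_term_ge0 (W : finType) (n d : nat) (p : R) (F : sgraph W) : 0 < p ->
  0 <= (20 * #|W|%:R / n%:R) ^+ #|endpoints F| *
    (d.+1%:R ^+ edge_cover_number F / p ^+ #|F|).
Proof.
by move=> p0; rewrite mulr_ge0 ?divr_ge0 ?exprn_ge0 ?divr_ge0 ?mulr_ge0// ltW.
Qed.

(* A single edge of H contributes at least (20 #|W| / n)^2. *)
Lemma Phi_ge1 (W : finType) (H : sgraph W) (n d : nat) (p : R) :
  H != finset.set0 -> 0 < p <= 1 -> (0 < n)%N -> (n <= 63 * #|W|)%N ->
  1 <= 10 * Phi n d p H.
Proof.
move=> /set0Pn[e eH] /andP[p0 p1] n0 nW.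
have single : nonempty_sub H [set e]%SET.
  by rewrite /nonempty_sub finset.sub1set eH andbT; apply/set0Pn; exists e; rewrite !inE.
rewrite /Phi (bigD1 [set e]%SET)//= endpoints1.
set rest := \sum_(_ | _) _.
have rest0 : 0 <= rest by apply: sumr_ge0 => F _; apply: Phi_term_ge0.
set c := _ / p ^+ _; set r := 20 * _ / _.
have c1 : 1 <= c.
  rewrite /c cards1 expr1 ler_pdivlMr// mul1r (le_trans p1)//.
  by rewrite exprn_ege1// ler1n.
have r1 : 20 / 63 <= r.
  have n0R : 0 < n%:R :> R by rewrite ltr0n.
  have nWR : n%:R <= 63 * #|W|%:R :> R by rewrite -natrM ler_nat.
  by rewrite /r ler_pdivlMr//; lra.
(* This fixes the threshold: 63 is the largest integer m with 10 (20 / m)^2 >= 1. *)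
have r2 : 1 / 10 <= r ^+ 2.
  apply: (@le_trans _ _ ((20 / 63) ^+ 2)); first by lra.
  by rewrite lerXn2r// nnegrE; lra.
nra.
Qed.

(** As 0.085^2 > 0.007, the constant obtained is 2 / (36 * 0.007) < 8. *)
Lemma second_moment_ratio (S N I C q : R) :
  0 <= S -> 0 < I -> 17 / 200 * I <= N -> S * N ^+ 2 <= 2 * C ->
  C <= 36^-1 * q * (I * I) -> 0 <= q -> S <= 10 * q.
Proof.
move=> S0 I0 NI SN Cq q0.
have II0 : 0 < I * I by rewrite mulr_gt0.
have N2 : 7 / 1000 * (I * I) <= N ^+ 2.
  have e0 : 0 <= 17 / 200 * I by lra.
  apply: (@le_trans _ _ ((17 / 200 * I) ^+ 2)).
    by rewrite exprMn expr2 ler_wpM2r// ?ltW//; lra.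
  by rewrite lerXn2r// nnegrE// (le_trans e0).
have : S * (7 / 1000 * (I * I)) <= 2 * (36^-1 * q * (I * I)).
  apply: le_trans (ler_wpM2l S0 N2) _; apply: le_trans SN _.
  by rewrite ler_wpM2l.
by rewrite !mulrA -!(mulrA _ I) ler_pM2r//; lra.
Qed.

Lemma no_copy_prob_le (W : finType) (H : sgraph W) (n d : nat) (p : R)
    (P : probability (sgraph 'I_n) R) :
  H != finset.set0 -> 0 < p <= 1 -> (0 < n)%N ->
  d%:R * #|H|%:R * #|W|%:R / n%:R < 9 / 10 :> R ->
  dependent_random_graph P p d ->
  (P [set G : sgraph 'I_n | ~ contains_copy H G] <= (10 * Phi n d p H)%:E)%E.
Proof.
move=> H0 p01 n0 dHW [Pp [D [DD degD]]].
(* For n < 63 #|W| the claimed bound is at least 1. *)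
have [Wn|/ltnW nW] := leqP (63 * #|W|) n; last first.
  apply: (@le_trans _ _ 1%E); first exact: probability_le1.
  by rewrite lee_fin; apply: Phi_ge1.
have /andP[p0 p1] := p01.
apply: (@le_trans _ _ (P [set G : sgraph 'I_n | no_copy H G])).
  by apply: le_measure; rewrite ?inE//; move=> G; apply: no_copyN.
rewrite (prob_sum P (no_copy H)) lee_fin.
have := second_moment H p0 (mass_ge0 P) (mass_sum P) (mass_indep Pp DD).
set S := \sum_(G | _) _; set N : R := #|good _ _|%:R.
have S0 : 0 <= S by apply: sumr_ge0 => G _; apply: mass_ge0.
set I : R := #|@injs W 'I_n|%:R.
have I0 : 0 < I by rewrite ltr0n injs_gt0// card_ord; lia.
(* 17 / 200 = 1 - 0.915, see [dHtheta_le]. *)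
have NI : 17 / 200 * I <= N.
  apply: (le_trans _ (@card_good_ge R W _ (card_lt_ord Wn n0) H (dnear D) d (@dnear2 _ D) _));
    last first.
    by move=> T; apply: dnear_degree.
  rewrite ler_wpM2r ?(ltW I0)// card_ord.
  have := dHtheta_le Wn n0 dHW; lra.
set C := \sum_(F | _) _ => SN.
have CPhi : C <= 36^-1 * Phi n d p H * (I * I).
  rewrite /C /Phi mulr_sumr mulr_suml; apply: ler_sum => F HF.
  apply: le_trans (ler_wpM2l _ (charged_coeff Wn n0 dHW degD HF)) _.
    by rewrite invr_ge0 exprn_ge0// ltW.
  rewrite -/I le_eqVlt; apply/orP; left; apply/eqP.
  by rewrite mulrA mulrCA -!mulrA; congr (_ * (_ * _)); rewrite mulrCA mulrC !mulrA.
have Phi0 : 0 <= Phi n d p H by apply: sumr_ge0 => F _; apply: Phi_term_ge0.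
exact: second_moment_ratio S0 I0 NI SN CPhi Phi0.
Qed.

End CopyProbability.

(** * The threshold in terms of the maximum density *)

Section Threshold.
Set Implicit Arguments.
Unset Strict Implicit.
Variables (R : realType) (W : finType) (H : sgraph W).
Hypothesis H0 : H != finset.set0.

Lemma density_le (F : sgraph W) : nonempty_sub H F ->
  #|F|%:R / #|endpoints F|%:R <= max_density R H.
Proof. by move=> HF; rewrite /max_density; apply: le_bigmax_cond. Qed.

Lemma max_density_gt0 : 0 < max_density R H.
Proof.
have HH : nonempty_sub H H by rewrite /nonempty_sub H0 fintype.subxx.
apply: lt_le_trans (density_le HH); rewrite divr_gt0// ltr0n.
  by rewrite card_gt0.
by have /andP[_] := edge_cover_number_lt H0; apply: leq_ltn_trans.
Qed.

Variables (n d : nat) (p : R).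
Hypotheses (n0 : (0 < n)%N) (p01 : 0 < p <= 1).
Let z : R := n%:R / d.+1%:R.
Let omega : R := p * z `^ (max_density R H)^-1.

Let z0 : 0 < z. Proof. by rewrite divr_gt0 ?ltr0n. Qed.

(** As p <= 1, [omega] is at most z^(1/m), so a large [omega] forces a large [z]. *)
Lemma omega_le_base (b : R) : 0 <= b -> b `^ (max_density R H)^-1 <= omega -> b <= z.
Proof.
move=> b0 bo; rewrite leNgt; apply/negP => zb.
have : z `^ (max_density R H)^-1 < b `^ (max_density R H)^-1.
  by apply: gt0_ltr_powR; rewrite ?nnegrE ?invr_gt0 ?max_density_gt0// ltW.
have := powR_ge0 z (max_density R H)^-1; move: bo; rewrite /omega.
by move: p01; nra.
Qed.

(** Write p^e = omega^e / z^(e/m). As e / m <= v and z >= 1, z^(e/m) is at most z^v, which cancels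
    n^v against (d+1)^v >= (d+1)^f; and omega^e >= omega. *)
Lemma Phi_le_omega : 1 <= omega ->
  Phi n d p H <=
    (\sum_(F : sgraph W | nonempty_sub H F) (20 * #|W|%:R) ^+ #|endpoints F|) / omega.
Proof.
move=> o1; have /andP[p0 p1] := p01.
have z1 : 1 <= z by apply: omega_le_base; rewrite ?powR1.
rewrite /Phi mulr_suml; apply: ler_sum => F HF.
have /andP[F0 FH] := HF; have /andP[f0 fv] := edge_cover_number_lt F0.
set v := #|endpoints F| in fv *; set f := edge_cover_number F in f0 fv *.
have e0 : (0 < #|F|)%N by rewrite card_gt0.
set e := #|F| in e0 *.
rewrite expr_div_n -mulrA ler_wpM2l ?exprn_ge0 ?mulr_ge0//.
set a := (max_density R H)^-1 in o1 *.
have o0 : 0 < omega := lt_le_trans ltr01 o1.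
have ze : (z `^ a) ^+ e <= z ^+ v.
  rewrite -powR_mulrn ?powR_ge0// -powRrM -(powR_mulrn _ (ltW z0)).
  apply: ler_powR => //; have := density_le HF; rewrite -/e -/v.
  rewrite ler_pdivrMr ?ltr0n ?(leq_ltn_trans _ fv)// => ev.
  by rewrite /a mulrC ler_pdivrMr ?max_density_gt0// mulrC.
have oe : omega <= omega ^+ e by rewrite ler_eXnr.
have -> : p ^+ e = omega ^+ e / (z `^ a) ^+ e.
  by rewrite /omega exprMn mulfK// expf_neq0// gt_eqF// powR_gt0.
have n0R : 0 < n%:R :> R by rewrite ltr0n.
have d0R : 0 < d.+1%:R :> R by rewrite ltr0n.
have df : d.+1%:R ^+ f <= d.+1%:R ^+ v :> R.
  by rewrite ler_weXn2l ?ler1n// ltnW.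
rewrite invfM invrK.
apply: (@le_trans _ _ ((n%:R ^+ v)^-1 * (d.+1%:R ^+ v * (omega ^-1 * z ^+ v)))).
  rewrite ler_wpM2l ?invr_ge0 ?exprn_ge0//.
  apply: ler_pM => //.
    by rewrite mulr_ge0 ?invr_ge0 ?exprn_ge0 ?powR_ge0// (ltW o0).
  apply: ler_pM => //.
  - by rewrite invr_ge0 exprn_ge0 ?(ltW o0).
  - by rewrite exprn_ge0 ?powR_ge0.
  by rewrite lef_pV2 ?posrE ?exprn_gt0.
rewrite /z expr_div_n le_eqVlt; apply/orP; left; apply/eqP.
have nv : n%:R ^+ v != 0 :> R by rewrite expf_neq0 ?gt_eqF.
have dv : d.+1%:R ^+ v != 0 :> R by rewrite expf_neq0 ?gt_eqF.
move: nv dv; move: (n%:R ^+ v) (d.+1%:R ^+ v) => x y x0 y0.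
by field; rewrite y0 x0 gt_eqF.
Qed.

(** The assumption gives z >= 2 #|H| #|W|, so the left side is at most d / (2 (d + 1)) < 1/2. *)
Lemma sparse_of_omega :
  (2 * (#|H|%:R * #|W|%:R)) `^ (max_density R H)^-1 <= omega ->
  d%:R * #|H|%:R * #|W|%:R / n%:R < 9 / 10 :> R.
Proof.
set c : R := #|H|%:R * #|W|%:R => co.
have c0 : 0 <= c by rewrite mulr_ge0.
have cz : 2 * c <= z by apply: omega_le_base co; rewrite mulr_ge0.
have n0R : 0 < n%:R :> R by rewrite ltr0n.
have d0 : 0 <= d%:R :> R by [].
rewrite -(mulrA d%:R) -/c ltr_pdivrMr//.
move: cz; rewrite /z ler_pdivlMr ?ltr0n// -natr1 => cz.
nra.
Qed.

End Threshold.

(** * Almost sure appearance of a fixed graph *)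

Section AlmostSure.
Set Implicit Arguments.
Unset Strict Implicit.
Variables (R : realType) (d : nat -> nat) (p : nat -> R).
Hypothesis hp : forall n, 0 < p n <= 1.
Variables (W : finType) (H : sgraph W).
Hypothesis H0 : H != finset.set0.

Lemma copy_prob (n : nat) (P : probability (sgraph 'I_n) R) :
  P [set G : sgraph 'I_n | contains_copy H G] =
  (1 - P [set G : sgraph 'I_n | ~ contains_copy H G])%E.
Proof.
rewrite -probability_setC//; congr (P _); apply/seteqP; split=> G /=.
  by move=> cG; apply.
exact: contrapT.
Qed.

Lemma copy_prob_cvg (P : forall n, probability (sgraph 'I_n) R) :
  p n * (n%:R / (d n).+1%:R) `^ (max_density R H)^-1 @[n --> \oo] --> +oo ->
  (forall n, dependent_random_graph (P n) (p n) (d n)) ->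
  P n [set G : sgraph 'I_n | contains_copy H G] @[n --> \oo] --> 1%E.
Proof.
move=> /cvgryPge omega_oo PP.
have finP n : P n [set G : sgraph 'I_n | contains_copy H G] \is a fin_num.
  exact: fin_num_measure.
apply: cvg_EFin; first by near=> n; exact: finP.
apply/cvgrPdist_le => eps eps0.
pose C : R := \sum_(F : sgraph W | nonempty_sub H F) (20 * #|W|%:R) ^+ #|endpoints F|.
have C0 : 0 <= C by apply: sumr_ge0 => F _; rewrite exprn_ge0 ?mulr_ge0.
near=> n.
have n0 : (0 < n)%N by near: n; exact: nbhs_infty_gt.
have o1 : 1 <= p n * (n%:R / (d n).+1%:R) `^ (max_density R H)^-1.
  by near: n; exact: omega_oo.
have oHW : (2 * (#|H|%:R * #|W|%:R)) `^ (max_density R H)^-1 <=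
    p n * (n%:R / (d n).+1%:R) `^ (max_density R H)^-1.
  by near: n; exact: omega_oo.
(* Makes the bound 10 * C / omega on the probability of no copy at most [eps]. *)
have oeps : 10 * C / eps <= p n * (n%:R / (d n).+1%:R) `^ (max_density R H)^-1.
  by near: n; exact: omega_oo.
have := no_copy_prob_le H0 (hp n) n0 (sparse_of_omega H0 n0 (hp n) oHW) (PP n).
have := Phi_le_omega H0 n0 (hp n) o1; rewrite -/C.
set o := p n * _ in o1 oHW oeps *; set q := P n [set G | ~ _].
have q0 : (0 <= q)%E by exact: measure_ge0.
have qfin : q \is a fin_num by exact: fin_num_measure.
move=> PhiC; rewrite /= copy_prob -/q.
move: q0; rewrite -(fineK qfin) !lee_fin => q0 qPhi.
rewrite -EFinB /= opprB addrC subrK ger0_norm//.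
apply: le_trans qPhi _; apply: (@le_trans _ _ (10 * (C / o))).
  by rewrite ler_wpM2l.
have o0 : 0 < o := lt_le_trans ltr01 o1.
rewrite mulrA ler_pdivrMr//.
by move: oeps; rewrite ler_pdivrMr// [eps * o]mulrC.
Unshelve. all: by end_near.
Qed.

End AlmostSure.

Theorem theorem7 (R : realType) (d : nat -> nat) (p : nat -> R)
    (hp : forall n, 0 < p n <= 1) :
  (forall (W : nat -> finType) (H : forall n, sgraph (W n)),
     (forall n, H n != finset.set0) ->
     forall n : nat, (0 < n)%N ->
       (d n)%:R * #|H n|%:R * #|W n|%:R / n%:R < 9 / 10 :> R ->
       forall P : probability (sgraph 'I_n) R,
         dependent_random_graph P (p n) (d n) ->
         (P [set G : sgraph 'I_n | ~ contains_copy (H n) G]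
            <= (10 * Phi n (d n) (p n) (H n))%:E)%E)
  /\
  (forall (W : finType) (H : sgraph W),
     H != finset.set0 ->
     p n * (n%:R / (d n).+1%:R) `^ (max_density R H)^-1 @[n --> \oo] --> +oo ->
     forall P : forall n, probability (sgraph 'I_n) R,
       (forall n, dependent_random_graph (P n) (p n) (d n)) ->
       P n [set G : sgraph 'I_n | contains_copy H G] @[n --> \oo] --> 1%E).
Proof.
split=> [W H H0 n n0 dHW P PP|W H H0 omega_oo P PP].
  exact: no_copy_prob_le.
exact: (copy_prob_cvg hp H0 omega_oo PP).
Qed.
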